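(* Let $d\ge 2$ and $r\ge 2$ be integers, let $A$ be a real $d\times d$ Frolov matrix (as defined in the context), and let $w:\mathbb{R}\to\mathbb{R}$ be an infinitely differentiable function with $\operatorname{supp}(w)\subset(-1/2,3/2)$ and $\sum_{k\in\mathbb{Z}}w(t+k)=1$ for all $t\in\mathbb{R}$. There exist a constant $c(d,A,r)>0$, depending only on $d,A,r$, and a constant $C(d,A,r,w)$, depending only on $d,A,r,w$, such that for every $a>1$ and every $v\ge v_0:=c(d,A,r)a^{-d}$ we have, for all $\mathbf u\in(0,1/2]^d$ with $pr(\mathbf u)=v$ and all $\mathbf z\in[0,1)^d$, $$ \left|\Phi(a,A,w)\big(\tilde h^r(\cdot,\mathbf z,\mathbf u)\big)-\hat{\tilde h}^r(\mathbf 0,\mathbf z,\mathbf u)\right|\le C(d,A,r,w)\,a^{-rd}\,\big(\log(2v/v_0)\big)^{d-1}. $$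
   Context: **Frolov matrix.** A real $d\times d$ (invertible) matrix $A$ is called here a Frolov matrix if, writing $L(\mathbf m)=A\mathbf m=(L_1(\mathbf m),\dots,L_d(\mathbf m))^T$ for column vectors $\mathbf m\in\mathbb{Z}^d$, it satisfies: (1) $\left|\prod_{j=1}^d L_j(\mathbf m)\right|\ge 1$ for all $\mathbf m\in\mathbb{Z}^d$, $\mathbf m\ne\mathbf 0$; (2) each parallelepiped $P$ with volume $|P|$ whose edges are parallel to the coordinate axes contains no more than $|P|+1$ lattice points $L(\mathbf m)$, $\mathbf m\in\mathbb{Z}^d$. **Hat functions.** For $u>0$ let $h^1(x,u):=\chi_{[-u/2,u/2)}(x)$ (characteristic function of the interval, $x\in\mathbb{R}$), and inductively $h^r(\cdot,u):=h^{r-1}(\cdot,u)*h^1(\cdot,u)$ for $r\ge2$, where $(f*g)(x)=\int_{\mathbb{R}}f(x-y)g(y)\,dy$. In particular $h^2(x,u)=\max(u-|x|,0)$. For $\mathbf x,\mathbf z\in\mathbb{R}^d$ and $\mathbf u\in(0,\infty)^d$ let $h^r(\mathbf x,\mathbf z,\mathbf u):=\prod_{j=1}^d h^r(x_j-z_j,u_j)$. Its periodization in $\mathbf x$ is $\tilde h^r(\mathbf x,\mathbf z,\mathbf u):=\sum_{\mathbf m\in\mathbb{Z}^d}h^r(\mathbf m+\mathbf x,\mathbf z,\mathbf u)$, and $\hat{\tilde h}^r(\mathbf 0,\mathbf z,\mathbf u):=\int_{[0,1)^d}\tilde h^r(\mathbf x,\mathbf z,\mathbf u)\,d\mathbf x$.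 Also $pr(\mathbf u):=\prod_{j=1}^d u_j$. **Cubature formula.** For $a>1$ let $\{\eta^\mu\}_{\mu=1}^m$ be an enumeration (with $m=m(a,A)$) of the finite set $\left\{\frac{(A^{-1})^T\mathbf m}{a}:\mathbf m\in\mathbb{Z}^d\right\}\cap[-1/2,3/2)^d$, and let $\xi^\mu:=\{\eta^\mu\}\in[0,1)^d$ be the vector of coordinatewise fractional parts of $\eta^\mu$. Put $w(\mathbf x):=\prod_{j=1}^d w(x_j)$. For $f$ defined on $[0,1)^d$, $$\Phi(a,A,w)(f):=\big(a^d|\det A|\big)^{-1}\sum_{\mu=1}^m w(\eta^\mu)f(\xi^\mu).$$ *)

(* Defs.v *)
From HB Require Import structures.
From mathcomp Require Import all_boot all_order all_algebra.
From mathcomp Require Import all_classical all_reals all_analysis.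

Set Implicit Arguments.
Unset Strict Implicit.
Unset Printing Implicit Defensive.

Import Order.TTheory GRing.Theory Num.Theory.
Import numFieldNormedType.Exports.

Local Open Scope classical_set_scope.
Local Open Scope ring_scope.

(* The n-fold product mu \x ... \x mu as a measure on n.-tuple T. *)
Section tuple_measure.
Context d (T : measurableType d) (R : realType).
Variable mu : {sigma_finite_measure set T -> \bar R}.
Local Open Scope ereal_scope.

Definition tcons n (p : T * n.-tuple T) : n.+1.-tuple T := [tuple of p.1 :: p.2].

Definition tuncons n (t : n.+1.-tuple T) : T * n.-tuple T :=
  (thead t, [tuple of behead t]).

Lemma measurable_tcons n : measurable_fun [set: T * n.-tuple T] (@tcons n).
Proof. exact: measurable_cons. Qed.

Lemma measurable_tuncons n : measurable_fun [set: n.+1.-tuple T] (@tuncons n).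
Proof.
apply: measurable_fun_pair; last exact: measurable_behead.
exact: measurable_tnth.
Qed.

Lemma tconsK n : cancel (@tcons n) (@tuncons n).
Proof. by move=> [x t]; congr pair; exact/val_inj. Qed.

Section step.
Variables (n : nat) (m : {sigma_finite_measure set (n.-tuple T) -> \bar R}).

Definition tuple_measureS : set (n.+1.-tuple T) -> \bar R :=
  pushforward (mu \x m) (@tcons n).

Let tuple_measureS0 : tuple_measureS set0 = 0.
Proof. by rewrite /tuple_measureS /pushforward preimage_set0 measure0. Qed.

Let tuple_measureS_ge0 A : 0 <= tuple_measureS A.
Proof. by rewrite /tuple_measureS /pushforward measure_ge0. Qed.

Let tuple_measureS_sigma_additive : semi_sigma_additive tuple_measureS.
Proof.
move=> F mF tF mUF; rewrite /tuple_measureS /pushforward preimage_bigcup.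
apply: measure_semi_sigma_additive.
- by move=> k; rewrite -[X in measurable X]setTI; exact: measurable_tcons.
- apply/trivIsetP => /= i j _ _ ij; rewrite -preimage_setI.
  by move/trivIsetP : tF => /(_ _ _ _ _ ij) ->//; rewrite preimage_set0.
- by rewrite -preimage_bigcup -[X in measurable X]setTI; exact: measurable_tcons.
Qed.

HB.instance Definition _ := isMeasure.Build _ _ _ tuple_measureS
  tuple_measureS0 tuple_measureS_ge0 tuple_measureS_sigma_additive.

Let tuple_measureS_sigma_finite : sigma_finite setT tuple_measureS.
Proof.
have /sigma_finiteP[F [TF ndF Foo]] := sigma_finiteT mu.
have /sigma_finiteP[G [TG ndG Goo]] := sigma_finiteT m.
exists (fun k => @tuncons n @^-1` (F k `*` G k)).
  rewrite -preimage_bigcup (_ : \bigcup_k _ = setT) ?preimage_setT//.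
  rewrite -setXTT TF TG predeqE => -[x y]; split=> [[k _ []]|].
    by move=> Fx Gy; split; exists k.
  move=> [/= [k _ Fx] [l _ Gy]]; exists (maxn k l) => //; split.
  - by move: x Fx; exact/subsetPset/ndF/leq_maxl.
  - by move: y Gy; exact/subsetPset/ndG/leq_maxr.
move=> k; have [mF Fk] := Foo k; have [mG Gk] := Goo k; split.
  rewrite -[X in measurable X]setTI; apply: measurable_tuncons => //.
  exact: measurableX.
rewrite /tuple_measureS /pushforward -comp_preimage.
rewrite (_ : _ @^-1` _ = F k `*` G k); last first.
  by apply/seteqP; split => p; rewrite /preimage /mkset /comp tconsK.
by rewrite product_measure1E// lte_mul_pinfty// ge0_fin_numE.
Qed.

HB.instance Definition _ := Measure_isSigmaFinite.Build _ _ _ tuple_measureS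
  tuple_measureS_sigma_finite.

End step.

Fixpoint tuple_measure n : {sigma_finite_measure set (n.-tuple T) -> \bar R} :=
  match n with
  | 0 => \d_[tuple]
  | n'.+1 => tuple_measureS (tuple_measure n')
  end.

Lemma measurable_tuple_box n (X : 'I_n -> set T) :
  (forall i, measurable (X i)) ->
  measurable [set t : n.-tuple T | forall i, X i (tnth t i)].
Proof.
move=> mX.
rewrite (_ : [set _ | _] = \bigcap_(i in [set: 'I_n]) (@tnth n T ^~ i @^-1` X i)).
  apply: fin_bigcap_measurable => // i _.
  by have := @measurable_tnth _ T n i measurableT _ (mX i); rewrite setTI.
by apply/seteqP; split => t /= tX i => [_|]; exact: tX.
Qed.

Lemma tuple_measure_box n (X : 'I_n -> set T) :
  (forall i, measurable (X i)) ->
  tuple_measure n [set t | forall i, X i (tnth t i)] = \prod_(i < n) mu (X i).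
Proof.
elim: n X => [|n IH] X mX.
  by rewrite big_ord0 /= diracE mem_set // => -[].
rewrite big_ord_recl -IH// /= /tuple_measureS /pushforward.
have mX' : forall i, measurable (X (lift ord0 i)) by [].
rewrite -(product_measure1E _ _ (mX ord0) (measurable_tuple_box mX')).
congr (_ _); apply/seteqP; split => -[x t] /= => [tX|[X0 tX] i].
  by split => [|i]; [exact: (tX ord0)|move: (tX (lift ord0 i)); rewrite tnthS].
by case: (unliftP ord0 i) => [j ->|->//]; rewrite tnthS; exact: tX.
Qed.

End tuple_measure.

Section frolov.
Context {R : realType} {d : nat}.
Implicit Types (A : 'M[R]_d) (x z u : 'cV[R]_d).

Definition box (lo hi : 'cV[R]_d) : set 'cV[R]_d :=
  [set x | forall i, lo i 0 <= x i 0 < hi i 0].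

Definition cbox (lo hi : 'cV[R]_d) : set 'cV[R]_d :=
  [set x | forall i, lo i 0 <= x i 0 <= hi i 0].

Definition Lform A (m : 'cV[int]_d) : 'cV[R]_d := A *m map_mx intr m.

Definition frolov A :=
  [/\ A \in unitmx,
      forall m, m != 0 -> 1 <= `|\prod_j Lform A m j 0| &
      forall lo hi : 'cV[R]_d, (forall i, lo i 0 < hi i 0) ->
        exists2 n : nat, (range (Lform A) `&` cbox lo hi #= `I_n)%card &
          n%:R <= \prod_i (hi i 0 - lo i 0) + 1].

(* (f * g)(x) = \int f(x - y) g(y) dy *)
Definition convolution (f g : R -> R) (x : R) : R :=
  \int[lebesgue_measure]_(y in setT) (f (x - y) * g y).

Definition hat1 (u : R) : R -> R := \1_(`[- (u / 2), u / 2[).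

Definition hat (r : nat) (u : R) : R -> R :=
  iter r.-1 (fun h => convolution h (hat1 u)) (hat1 u).

Definition hatd (r : nat) x z u : R := \prod_j hat r (u j 0) (x j 0 - z j 0).

(* The sum has finite support, since hat r u vanishes outside a bounded
   interval. *)
Definition phatd (r : nat) x z u : R :=
  \sum_(m \in [set: 'cV[int]_d]) hatd r (map_mx intr m + x) z u.

Definition cube_integral (f : 'cV[R]_d -> R) : R :=
  \int[tuple_measure (@lebesgue_measure R) d]_(t in
      [set t | box 0 (const_mx 1) (\col_i tnth t i)])
    f (\col_i tnth t i).

Definition frac x : 'cV[R]_d := map_mx (fun t => t - (Num.floor t)%:~R) x.

(* For invertible A and a > 0 this set is finite, so that the sum over it in
   cubature is the sum over an enumeration without repetition. *)
Definition nodes (a : R) A : set 'cV[R]_d :=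
  range (fun m : 'cV[int]_d => a^-1 *: ((invmx A)^T *m map_mx intr m)) `&`
  box (const_mx (- 2^-1)) (const_mx (3 / 2)).

Definition cubature (a : R) A (w : R -> R) (f : 'cV[R]_d -> R) : R :=
  (a ^+ d * `|\det A|)^-1 *
  \sum_(eta \in nodes a A) ((\prod_j w (eta j 0)) * f (frac eta)).

End frolov.

Definition infinitely_differentiable {R : realType} (f : R -> R) :=
  forall n t, derivable (f^`(n)%classic) t 1.

Definition supp {R : realType} (f : R -> R) : set R :=
  closure [set t | f t != 0].

(* Main.v *)
Require Import Defs.
From mathcomp Require Import all_boot all_order all_algebra.
From mathcomp Require Import all_classical all_reals all_analysis.
From mathcomp Require Import measurable_realfun ring lra zify.
From mathcomp.real_closed Require Import complex.
Set Implicit Arguments.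
Unset Strict Implicit.
Unset Printing Implicit Defensive.
Import Order.TTheory GRing.Theory Num.Theory.
Import numFieldNormedType.Exports.
Local Open Scope classical_set_scope.
Local Open Scope ring_scope.

(** The error of the cubature formula is the tail of a Poisson summation.

    Let B be the inverse transpose of A divided by a, and let F be the tensor
    product of the functions x |-> w x * h x, where h is the periodized hat of
    one coordinate. Since h is periodic and w vanishes outside the window, the
    cubature sum is |det B| times the sum of F over the lattice B Z^d
    ([cubature_grid]). Since the integer translates of w add up to 1, the
    integral of the periodized hat over the unit cube is the integral of F over
    R^d ([cube_integral_phatd], [factor_mean]). The lattice dual to B Z^d is
    a A Z^d, so the error should be the sum of the Fourier transform of F over
    the nonzero points of a A Z^d.

    Three estimates make this precise.

    - Fourier decay ([hat_oscillation], [tensor_oscillation]). A hat of order r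
      is an r-fold convolution of boxes of width u. Paired with w x cos (om x),
      each box gains either its mass u or, by an integration by parts, a factor
      1 / |om|. Hence the transform of F at a A m is at most a constant times
      the product over j of min (u_j, 1 / (a |L_j m|)) ^ r.

    - Lattice sum ([frolov_decay_sum]). Let s_j be the least natural number with
      a u_j |L_j m| <= 2 ^ s_j, and put T = a^d pr(u). The product above is about
      (pr(u) 2 ^ (- |s|)) ^ r with |s| the sum of the s_j. The first Frolov
      property, a lower bound for |L_1 m ... L_d m|, gives 2 ^ |s| >= T; the
      second one bounds the number of m with a given s by a constant times
      2 ^ |s| / T. About n ^ (d - 1) vectors s have |s| = n, and r >= 2 makes the
      sum over n geometric, so everything is of the size of its first block
      2 ^ |s| ~ T, namely pr(u)^r T^(-r) (log 2T)^(d-1) =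
      a^(- r d) (log 2T)^(d-1). This needs T >= 1, so the constant c can be 1.

    - Poisson summation as an inequality ([lattice_sum_error]). To avoid
      discussing convergence of Fourier series, F \o B is integrated against a
      product of Fejer kernels. This is an average over j of finite sums over l
      of transforms of F at the dual points of index j - l; the diagonal l = j
      gives the integral of F, and for each j the other terms are bounded by the
      lattice sum. As the order of the kernels grows, the integral tends to the
      sum of F \o B over Z^d, because F is Lipschitz with bounded support
      ([fejer_sampling]). *)

(** * Change of variables *)

Section change_of_variables.
Context d (T : measurableType d) {R : realType} (mu : {measure set T -> \bar R}).
Variables (phi : T -> T) (k : R).
Hypotheses (mphi : measurable_fun setT phi) (k0 : 0 < k).
Hypothesis ge0_phi : forall f : T -> \bar R, measurable_fun setT f ->
  (forall x, 0 <= f x)%E -> (k%:E * \int[mu]_x f (phi x) = \int[mu]_x f x)%E.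

(** A change of variables formula known for nonnegative functions extends to
    integrable ones. The next two lemmas do this once for affine maps of the
    line and for linear maps of tuples. *)
Lemma integrable_change (f : T -> R) : mu.-integrable setT (EFin \o f) ->
  mu.-integrable setT (EFin \o (f \o phi)).
Proof.
move=> /integrableP[mf foo]; apply/integrableP; split.
  exact: measurableT_comp mf mphi.
rewrite -(@lte_pmul2l _ k%:E)// mulry gtr0_sg// mul1e.
have -> := @ge0_phi (fun x => `|(f x)%:E|%E) _ _ => //.
exact: measurableT_comp.
Qed.

Lemma Rintegral_change (f : T -> R) : mu.-integrable setT (EFin \o f) ->
  k * \int[mu]_x f (phi x) = \int[mu]_x f x.
Proof.
move=> fi; have fpi := integrable_change fi.
rewrite /Rintegral -[k in LHS]/(fine k%:E) -fineM//; last first.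
  exact: integrable_fin_num fpi.
congr fine; rewrite integralE [RHS]integralE.
have mf := measurable_int _ fi.
rewrite -(ge0_phi (measurable_funepos mf))//.
rewrite -(ge0_phi (measurable_funeneg mf))//.
rewrite muleBr//; last first.
  apply: fin_num_adde_defl; rewrite fin_numN.
  by have := integrable_neg_fin_num measurableT fpi.
congr (_ * _ + - (_ * _))%E; apply: eq_integral => x _.
  by rewrite !funeposE.
by rewrite !funenegE.
Qed.
End change_of_variables.

Section affine_line.
Context {R : realType}.
Local Notation mu := (@lebesgue_measure R).
Local Open Scope ereal_scope.

Lemma measurable_affine (b c : R) :
  measurable_fun [set: R] (fun x : R => (b * x + c)%R).
Proof. by apply: measurable_funD => //; exact: measurable_funM. Qed.

(** By uniqueness of the Lebesgue measure, it is enough to compare the two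
    sides on intervals. *)
Lemma lebesgue_measure_affine (b c : R) (A : set R) : (b != 0)%R -> measurable A ->
  mu A = `|b|%:E * mu ((fun x : R => (b * x + c)%R) @^-1` A).
Proof.
move=> b0 mA.
pose f (x : measurableTypeR R) : measurableTypeR R := (b * x + c)%R.
have mf : measurable_fun setT f by exact: measurable_affine.
pose P : {measure set (measurableTypeR R) -> \bar R} :=
  measure_function_pushforward__canonical__measure_function_Measure mu mf.
pose m : {measure set (measurableTypeR R) -> \bar R} := mscale (NngNum (normr_ge0 b)) P.
rewrite -[RHS]/(m A).
apply: lebesgue_measure_unique => // _ [[l r]] _ <-.
rewrite /m/= /mscale/= /pushforward/=.
case: (ltrgtP b 0%R) b0 => // b0 _.
- rewrite (_ : _ @^-1` _ = `[((r - c) / b)%R, ((l - c)/ b)%R[%classic).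
    rewrite !lebesgue_measure_itv /= !lte_fin.
    rewrite ltr_nM2r ?invr_lt0// ltrD2.
    case: ifPn => _; last by rewrite mule0.
    rewrite ?ltr0_norm// -EFinB -EFinM; congr EFin; field; exact: ltr0_neq0.
  apply/seteqP; split => x /=; rewrite !in_itv/= /f ler_ndivrMr// ltr_ndivlMr//.
    by move=> /andP[? ?]; apply/andP; split; lra.
  by move=> /andP[? ?]; apply/andP; split; lra.
- rewrite (_ : _ @^-1` _ = `]((l - c) / b)%R, ((r - c)/ b)%R]%classic).
    rewrite !lebesgue_measure_itv /= !lte_fin.
    rewrite ltr_pM2r ?invr_gt0// ltrD2.
    case: ifPn => _; last by rewrite mule0.
    rewrite ?gtr0_norm// -EFinB -EFinM; congr EFin; field; exact: lt0r_neq0.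
  apply/seteqP; split => x /=; rewrite !in_itv/= /f ler_pdivlMr// ltr_pdivrMr//.
    by move=> /andP[? ?]; apply/andP; split; lra.
  by move=> /andP[? ?]; apply/andP; split; lra.
Qed.

Lemma ge0_integral_affine (b c : R) (f : R -> \bar R) : (b != 0)%R ->
  measurable_fun setT f -> (forall x, 0 <= f x) ->
  `|b|%:E * \int[mu]_x f (b * x + c)%R = \int[mu]_x f x.
Proof.
move=> b0 mf f0.
pose g (x : measurableTypeR R) : measurableTypeR R := (b * x + c)%R.
have mg : measurable_fun setT g by exact: measurable_affine.
rewrite -[X in _ * X](@ge0_integral_pushforward _ _ _ _ _ g mg mu setT f)//.
rewrite -(ge0_integral_mscale _ _ (NngNum (normr_ge0 b)))//.
apply: eq_measure_integral => A mA _.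
exact/esym/lebesgue_measure_affine.
Qed.

Lemma integrable_affine (b c : R) (f : R -> R) : (b != 0)%R ->
  mu.-integrable setT (EFin \o f) ->
  mu.-integrable setT (EFin \o (fun x => f (b * x + c)%R)).
Proof.
move=> b0; apply: (@integrable_change _ _ _ mu (fun x => (b * x + c)%R) `|b|%R).
- exact: measurable_affine.
- by rewrite normr_gt0.
- by move=> g mg g0; exact: ge0_integral_affine.
Qed.

Lemma Rintegral_affine (b c : R) (f : R -> R) : (b != 0)%R ->
  mu.-integrable setT (EFin \o f) ->
  (`|b| * \int[mu]_x f (b * x + c) = \int[mu]_x f x)%R.
Proof.
move=> b0; apply: (@Rintegral_change _ _ _ mu (fun x => (b * x + c)%R) `|b|%R).
- exact: measurable_affine.
- by rewrite normr_gt0.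
- by move=> g mg g0; exact: ge0_integral_affine.
Qed.
End affine_line.

(** * Iterated integrals on tuples *)

Section tuple_tonelli.
Context d (T : measurableType d) (R : realType).
Variable mu : {sigma_finite_measure set T -> \bar R}.
Local Open Scope ereal_scope.

Lemma ge0_integral_tcons n (f : n.+1.-tuple T -> \bar R) :
  measurable_fun setT f -> (forall t, 0 <= f t) ->
  \int[tuple_measure mu n.+1]_t f t =
  \int[mu \x tuple_measure mu n]_p f (tcons p).
Proof.
move=> mf f0.
rewrite (ge0_integral_pushforward (@measurable_tcons _ T n)
  (mu \x tuple_measure mu n))//.
Qed.

Lemma tuple_tonelli1 n (f : n.+1.-tuple T -> \bar R) :
  measurable_fun setT f -> (forall t, 0 <= f t) ->
  \int[tuple_measure mu n.+1]_t f t =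
  \int[mu]_x \int[tuple_measure mu n]_t f (tcons (x, t)).
Proof.
move=> mf f0; rewrite ge0_integral_tcons// fubini_tonelli1//.
exact: measurableT_comp mf (@measurable_tcons _ T n).
Qed.

Lemma tuple_tonelli2 n (f : n.+1.-tuple T -> \bar R) :
  measurable_fun setT f -> (forall t, 0 <= f t) ->
  \int[tuple_measure mu n.+1]_t f t =
  \int[tuple_measure mu n]_t \int[mu]_x f (tcons (x, t)).
Proof.
move=> mf f0; rewrite ge0_integral_tcons// fubini_tonelli2//.
exact: measurableT_comp mf (@measurable_tcons _ T n).
Qed.

Lemma thead_tcons n (p : T * n.-tuple T) : thead (tcons p) = p.1.
Proof. by []. Qed.

Lemma behead_tcons n (p : T * n.-tuple T) : [tuple of behead (tcons p)] = p.2.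
Proof. exact/val_inj. Qed.

Lemma integrable_tcons n (f : T -> R) (g : n.-tuple T -> R) :
  mu.-integrable setT (EFin \o f) ->
  (tuple_measure mu n).-integrable setT (EFin \o g) ->
  (tuple_measure mu n.+1).-integrable setT
    (fun t => (f (thead t) * g [tuple of behead t])%:E).
Proof.
move=> fi gi.
have mf : measurable_fun setT f by apply/measurable_EFinP; exact: measurable_int fi.
have mg : measurable_fun setT g by apply/measurable_EFinP; exact: measurable_int gi.
have mh : measurable_fun setT
  (fun t : n.+1.-tuple T => (f (thead t) * g [tuple of behead t])%:E).
  apply/measurable_EFinP; apply: measurable_funM.
    by apply: measurableT_comp => //; exact: measurable_tnth.
  by apply: measurableT_comp => //; exact: measurable_behead.
apply/integrableP; split => //.
rewrite tuple_tonelli1//; last exact: measurableT_comp.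
under eq_integral => x _.
  under eq_integral => t _ do
    rewrite thead_tcons behead_tcons /= normrM EFinM.
  rewrite ge0_integralZl//; last first.
    by apply/measurable_EFinP; exact: measurableT_comp.
  over.
rewrite ge0_integralZr//.
- have /integrableP[_ fo] := fi; have /integrableP[_ go] := gi.
  by rewrite lte_mul_pinfty ?ge0_fin_numE ?integral_ge0.
- by apply/measurable_EFinP; exact: measurableT_comp.
- exact: integral_ge0.
Qed.

Lemma Rintegral_tcons n (f : T -> R) (g : n.-tuple T -> R) :
  mu.-integrable setT (EFin \o f) ->
  (tuple_measure mu n).-integrable setT (EFin \o g) ->
  (\int[tuple_measure mu n.+1]_t (f (thead t) * g [tuple of behead t]) =
  (\int[mu]_x f x) * \int[tuple_measure mu n]_t g t)%R.
Proof.
move=> fi gi; have fgi := integrable_tcons fi gi.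
pose h := (fun t : n.+1.-tuple T => (f (thead t) * g [tuple of behead t])%:E).
have mh : measurable_fun setT h by exact: measurable_int fgi.
have hi : (mu \x tuple_measure mu n).-integrable setT (h \o @tcons _ T n).
  apply/integrableP; split; first exact: measurableT_comp mh (@measurable_tcons _ T n).
  have /integrableP[_] := fgi.
  by rewrite ge0_integral_tcons//; exact: measurableT_comp.
rewrite /Rintegral.
rewrite (_ : \int[_]_t _ = \int[mu \x tuple_measure mu n]_p h (tcons p)); last first.
  by rewrite (integral_pushforward (@measurable_tcons _ T n)
    (mu := mu \x tuple_measure mu n) (f := h)).
rewrite -(integral12_prod_meas1 hi).
set c := \int[tuple_measure mu n]_t (g t)%:E.
have cfin : c \is a fin_num by exact: integrable_fin_num gi.
rewrite -fineM//; last exact: integrable_fin_num fi.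
rewrite -[c]fineK// -integralZr//; congr fine; apply: eq_integral => x _.
rewrite fineK// /fubini_F /= /h.
under eq_integral => t _ do rewrite thead_tcons behead_tcons /= EFinM.
by rewrite integralZl.
Qed.
End tuple_tonelli.

(** * Integrals of sums, products and tensor products *)

Section real_integrable.
Context d (T : measurableType d) (R : realType) (mu : {measure set T -> \bar R}).
Implicit Types f g : T -> R.

Lemma integrable_add f g : mu.-integrable setT (EFin \o f) ->
  mu.-integrable setT (EFin \o g) ->
  mu.-integrable setT (EFin \o (fun x => f x + g x)).
Proof. by move=> fi gi; apply: eq_integrable (integrableD _ fi gi). Qed.

Lemma integrable_sub f g : mu.-integrable setT (EFin \o f) ->
  mu.-integrable setT (EFin \o g) ->
  mu.-integrable setT (EFin \o (fun x => f x - g x)).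
Proof. by move=> fi gi; apply: eq_integrable (integrableB _ fi gi). Qed.

Lemma integrable_scale (k : R) f : mu.-integrable setT (EFin \o f) ->
  mu.-integrable setT (EFin \o (fun x => k * f x)).
Proof. by move=> fi; apply: eq_integrable (integrableZl measurableT k fi). Qed.

Lemma integrable_sumr (I : Type) (s : seq I) (P : pred I) (f : I -> T -> R) :
  (forall i, P i -> mu.-integrable setT (EFin \o f i)) ->
  mu.-integrable setT (EFin \o (fun x => \sum_(i <- s | P i) f i x)).
Proof.
move=> fi; elim: s => [|i s IH].
  apply: eq_integrable (integrable0 mu setT) => //.
  by move=> x _ /=; rewrite big_nil.
case: (boolP (P i)) => Pi.
  apply: eq_integrable (integrableD _ (fi _ Pi) IH) => //.
  by move=> x _ /=; rewrite big_cons Pi.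
by apply: eq_integrable IH => // x _ /=; rewrite big_cons (negbTE Pi).
Qed.

Lemma Rintegral_sumr (I : Type) (s : seq I) (P : pred I) (f : I -> T -> R) :
  (forall i, P i -> mu.-integrable setT (EFin \o f i)) ->
  \int[mu]_x (\sum_(i <- s | P i) f i x) = \sum_(i <- s | P i) \int[mu]_x f i x.
Proof.
move=> fi; elim: s => [|i s IH].
  rewrite big_nil; under eq_Rintegral do rewrite big_nil.
  by rewrite Rintegral_cst// mul0r.
rewrite big_cons; under eq_Rintegral do rewrite big_cons.
case: (boolP (P i)) => // Pi.
by rewrite RintegralD// ?IH//; [exact: fi|exact: integrable_sumr].
Qed.

Lemma integrable_mul_bounded f (h : T -> R) (M : R) :
  mu.-integrable setT (EFin \o f) -> measurable_fun setT h ->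
  (forall x, `|h x| <= M) ->
  mu.-integrable setT (EFin \o (fun x => f x * h x)).
Proof.
move=> fi mh hM.
have -> : EFin \o (fun x => f x * h x) = ((EFin \o f) \* (EFin \o h))%E by [].
apply: integrableMl => //; exists M; split; first exact: num_real.
by move=> y My x _ /=; apply: le_trans (hM x) (ltW My).
Qed.

Lemma integrable_norm f : mu.-integrable setT (EFin \o f) ->
  mu.-integrable setT (EFin \o (fun x => `|f x|)).
Proof. by move=> fi; apply: eq_integrable (integrable_abse fi). Qed.
End real_integrable.

Section product_integrals.
Context d (T : measurableType d) (R : realType).
Variable mu : {sigma_finite_measure set T -> \bar R}.

Lemma prod_tnthS n (f : 'I_n.+1 -> T -> R) (t : n.+1.-tuple T) :
  \prod_i f i (tnth t i) =
  f ord0 (thead t) * \prod_i f (lift ord0 i) (tnth [tuple of behead t] i).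
Proof.
rewrite big_ord_recl; congr (_ * _); apply: eq_bigr => i _.
by rewrite [in LHS](tuple_eta t) tnthS.
Qed.

Lemma integrable_tuple0 (f : 0.-tuple T -> R) :
  (tuple_measure mu 0).-integrable setT (EFin \o f).
Proof.
apply: measurable_bounded_integrable => //=.
- by rewrite diracT ltry.
- by rewrite (_ : f = cst (f [tuple])) //; apply/funext => t; rewrite [t]tuple0.
- exists `|f [tuple]|; split; first exact: num_real.
  by move=> y yM t _; rewrite [t]tuple0; exact: ltW.
Qed.

Lemma Rintegral_tuple0 (f : 0.-tuple T -> R) :
  \int[tuple_measure mu 0]_t f t = f [tuple].
Proof.
rewrite (_ : f = cst (f [tuple])); last by apply/funext => t; rewrite [t]tuple0.
rewrite Rintegral_cst// [X in fine X]diracT mulr1.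
by [].
Qed.

Lemma integrable_tuple_prod n (f : 'I_n -> T -> R) :
  (forall i, mu.-integrable setT (EFin \o f i)) ->
  (tuple_measure mu n).-integrable setT
    (fun t => (\prod_i f i (tnth t i))%:E).
Proof.
elim: n f => [|n IH] f fi.
  exact: integrable_tuple0.
under eq_fun do rewrite prod_tnthS.
exact: (integrable_tcons (fi ord0) (IH _ (fun i => fi (lift ord0 i)))).
Qed.

Lemma Rintegral_tuple_prod n (f : 'I_n -> T -> R) :
  (forall i, mu.-integrable setT (EFin \o f i)) ->
  \int[tuple_measure mu n]_t \prod_i f i (tnth t i) =
  \prod_i \int[mu]_x f i x.
Proof.
elim: n f => [|n IH] f fi.
  by rewrite Rintegral_tuple0 !big_ord0.
under eq_Rintegral do rewrite prod_tnthS.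
have fi' (i : 'I_n) := fi (lift ord0 i).
rewrite (Rintegral_tcons (fi ord0) (integrable_tuple_prod fi')) big_ord_recl.
by congr (_ * _); exact: (IH _ fi').
Qed.
End product_integrals.

Section trigonometric_products.
Context {R : realType}.
Local Notation mu := (@lebesgue_measure R).

Lemma measurable_cosD (th ph : R) : measurable_fun setT (fun x : R => cos (th * x + ph)).
Proof.
apply: (measurableT_comp (f := @cos R)); last exact: measurable_affine.
by apply: continuous_measurable_fun; exact: continuous_cos.
Qed.

Lemma measurable_sinD (th ph : R) : measurable_fun setT (fun x : R => sin (th * x + ph)).
Proof.
apply: (measurableT_comp (f := @sin R)); last exact: measurable_affine.
by apply: continuous_measurable_fun; exact: continuous_sin.
Qed.

Lemma integrable_mul_cos (f : R -> R) (th ph : R) :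
  mu.-integrable setT (EFin \o f) ->
  mu.-integrable setT (EFin \o (fun x => f x * cos (th * x + ph))).
Proof.
move=> fi; apply: integrable_mul_bounded fi (measurable_cosD _ _) _ => x.
exact: cos_max.
Qed.

Lemma integrable_mul_sin (f : R -> R) (th ph : R) :
  mu.-integrable setT (EFin \o f) ->
  mu.-integrable setT (EFin \o (fun x => f x * sin (th * x + ph))).
Proof.
move=> fi; apply: integrable_mul_bounded fi (measurable_sinD _ _) _ => x.
exact: sin_max.
Qed.

(** This is the factorization of the Fourier transform of a tensor product, with
    the complex exponential split into its real and imaginary parts: the left
    hand side is the squared modulus of the transform at th. *)
Lemma tuple_trig_prod n (f : 'I_n -> R -> R) (th : 'I_n -> R) :
  (forall i, mu.-integrable setT (EFin \o f i)) ->
  let c t := \prod_i f i (tnth t i) * cos (\sum_i th i * tnth t i) in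
  let s t := \prod_i f i (tnth t i) * sin (\sum_i th i * tnth t i) in
  let nu := tuple_measure mu n in
  [/\ nu.-integrable setT (EFin \o c), nu.-integrable setT (EFin \o s) &
  (\int[nu]_t c t) ^+ 2 + (\int[nu]_t s t) ^+ 2 =
  \prod_i ((\int[mu]_x (f i x * cos (th i * x))) ^+ 2 +
           (\int[mu]_x (f i x * sin (th i * x))) ^+ 2)].
Proof.
elim: n f th => [|n IH] f th fi c s nu.
  split; [exact: integrable_tuple0|exact: integrable_tuple0|].
  by rewrite !Rintegral_tuple0 /c /s !big_ord0 cos0 sin0; ring.
have [] := IH (fun i => f (lift ord0 i)) (fun i => th (lift ord0 i)) _ => //.
set c' := fun t => _; set s' := fun t => _ => ci si IHe.
pose f0c x := f ord0 x * cos (th ord0 * x).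
pose f0s x := f ord0 x * sin (th ord0 * x).
have f0ci : mu.-integrable setT (EFin \o f0c).
  have := integrable_mul_cos (th ord0) 0 (fi ord0).
  by under eq_fun do rewrite addr0.
have f0si : mu.-integrable setT (EFin \o f0s).
  have := integrable_mul_sin (th ord0) 0 (fi ord0).
  by under eq_fun do rewrite addr0.
have sumE (t : n.+1.-tuple R) : \sum_i th i * tnth t i = th ord0 * thead t +
    \sum_(i < n) th (lift ord0 i) * tnth [tuple of behead t] i.
  rewrite big_ord_recl; congr (_ + _); apply: eq_bigr => i _.
  by rewrite [in LHS](tuple_eta t) tnthS.
have cE : c = fun t => f0c (thead t) * c' [tuple of behead t] -
                       f0s (thead t) * s' [tuple of behead t].
  by apply/funext => t; rewrite /c sumE cosD prod_tnthS /f0c /f0s /c' /s'; ring.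
have sE : s = fun t => f0s (thead t) * c' [tuple of behead t] +
                       f0c (thead t) * s' [tuple of behead t].
  by apply/funext => t; rewrite /s sumE sinD prod_tnthS /f0c /f0s /c' /s'; ring.
have cc := integrable_tcons f0ci ci; have cs := integrable_tcons f0ci si.
have sc := integrable_tcons f0si ci; have ss := integrable_tcons f0si si.
split.
- by rewrite cE; exact: integrable_sub cc ss.
- by rewrite sE; exact: integrable_add sc cs.
rewrite cE sE RintegralB// RintegralD// !Rintegral_tcons//.
by rewrite big_ord_recl -IHe /f0c /f0s; ring.
Qed.

End trigonometric_products.

(** * Linear changes of variables *)

Section linear_change.
Context {R : realType}.
Local Notation mu := (@lebesgue_measure R).

Definition mxtuple m n (B : 'M[R]_(m, n)) (t : n.-tuple R) : m.-tuple R :=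
  [tuple \sum_j B i j * tnth t j | i < m].

Lemma mxtuple_mul m n p (B : 'M[R]_(m, n)) (C : 'M[R]_(n, p)) t :
  mxtuple (B *m C) t = mxtuple B (mxtuple C t).
Proof.
apply: eq_from_tnth => i; rewrite !tnth_mktuple.
under eq_bigr => j _ do rewrite mxE mulr_suml.
rewrite exchange_big; apply: eq_bigr => j _ /=.
rewrite tnth_mktuple mulr_sumr; apply: eq_bigr => k _; exact/esym/mulrA.
Qed.

Lemma measurable_mxtuple m n (B : 'M[R]_(m, n)) :
  measurable_fun setT (mxtuple B).
Proof.
apply/measurable_fun_tnthP => i.
apply: (eq_measurable_fun (fun t => \sum_j B i j * tnth t j)).
  by move=> t _; rewrite /= tnth_mktuple.
apply: measurable_sum => j; apply: measurable_funM => //; exact: measurable_tnth.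
Qed.

Local Open Scope ereal_scope.

Lemma ge0_integral_translate n (a : 'I_n -> R) (f : n.-tuple R -> \bar R) :
  measurable_fun setT f -> (forall t, 0 <= f t) ->
  \int[tuple_measure mu n]_t f [tuple (tnth t i + a i)%R | i < n] =
  \int[tuple_measure mu n]_t f t.
Proof.
elim: n a f => [|n IH] a f mf f0.
  by apply: eq_integral => t _; congr f; rewrite tuple0; apply/esym/tuple0.
have mtr : measurable_fun setT
    (fun t : n.+1.-tuple R => [tuple (tnth t i + a i)%R | i < n.+1]).
  apply/measurable_fun_tnthP => i.
  rewrite (_ : _ \o _ = fun t : n.+1.-tuple R => (tnth t i + a i)%R); last first.
    by apply/funext => t; rewrite /= tnth_mktuple.
  by apply: measurable_funD => //; exact: measurable_tnth.
rewrite [LHS]tuple_tonelli1//; last exact: measurableT_comp.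
rewrite [RHS]tuple_tonelli1//.
rewrite -[RHS](@ge0_integral_affine _ 1%R (a ord0))//; last 2 first.
- apply: (measurable_fun_fubini_tonelli_F (m2 := tuple_measure mu n)
    (fun p => f (tcons p))) => //.
  exact: measurableT_comp mf (@measurable_tcons _ _ n).
- by move=> x; exact: integral_ge0.
rewrite normr1 mul1e; apply: eq_integral => x _.
rewrite -[RHS](IH (fun i => a (lift ord0 i)))//.
- apply: eq_integral => t _; congr f; apply: eq_from_tnth => i.
  case: (unliftP ord0 i) => [j ->|->]; rewrite tnth_mktuple ?tnthS ?tnth_mktuple//=.
  by rewrite tnth0 mul1r.
- apply: measurableT_comp mf _.
  by apply: measurable_cons => //; exact: measurable_id.
Qed.

Definition linear_scaling n (B : 'M[R]_n) := forall f : n.-tuple R -> \bar R,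
  measurable_fun setT f -> (forall t, 0 <= f t) ->
  `|\det B|%:E * \int[tuple_measure mu n]_t f (mxtuple B t) =
  \int[tuple_measure mu n]_t f t.

Lemma linear_scaling_mul n (B C : 'M[R]_n) :
  linear_scaling B -> linear_scaling C -> linear_scaling (B *m C).
Proof.
move=> sB sC f mf f0; rewrite det_mulmx normrM EFinM.
under eq_integral do rewrite mxtuple_mul.
rewrite -muleA (sC (f \o mxtuple B)) ?sB// => [|t]; last exact: f0.
by apply: measurableT_comp mf _; exact: measurable_mxtuple.
Qed.

(** In block form, a matrix acts on the head and the tail of a tuple, which is
    how the iterated integrals see it. *)
Lemma mxtuple_block n (b : R) (r : 'rV[R]_n) (c : 'cV[R]_n) (D : 'M[R]_n) x t :
  mxtuple (block_mx b%:M r c D) (tcons (x, t)) =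
  tcons ((b * x + \sum_j r 0 j * tnth t j)%R,
    [tuple (tnth (mxtuple D t) i + x * c i 0)%R | i < n]).
Proof.
apply: eq_from_tnth => i; rewrite tnth_mktuple big_ord_recl.
have l0 : ord0 = lshift n (ord0 : 'I_1) by apply/val_inj.
have ls (j : 'I_n) : lift ord0 j = rshift 1 j by apply/val_inj.
case: (unliftP ord0 i) => [j ->|->].
- rewrite tnthS !tnth_mktuple /= tnth0 [X in block_mx _ _ _ _ _ X]l0 ls.
  rewrite block_mxEdl addrC mulrC; congr (_ + _)%R.
  by apply: eq_bigr => k _; rewrite tnthS !ls block_mxEdr.
- rewrite !tnth0 /= [X in block_mx _ _ _ _ X]l0 [X in block_mx _ _ _ _ _ X]l0.
  rewrite block_mxEul mxE eqxx mulr1n; congr (_ + _)%R.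
  by apply: eq_bigr => k _; rewrite tnthS !ls block_mxEur.
Qed.

Lemma mxtuple1 n t : mxtuple (1%:M : 'M[R]_n) t = t.
Proof.
apply: eq_from_tnth => i; rewrite tnth_mktuple (bigD1 i)//= big1 ?addr0.
  by rewrite mxE eqxx mul1r.
by move=> j ji; rewrite mxE eq_sym (negbTE ji) mul0r.
Qed.

Lemma linear_scaling_lower n (c : 'cV[R]_n) :
  linear_scaling (block_mx 1%:M 0 c 1%:M : 'M[R]_(1 + n)).
Proof.
move=> f mf f0; rewrite det_lblock !det1 mulr1 normr1 mul1e.
rewrite [LHS]tuple_tonelli1//; last first.
  by apply: measurableT_comp mf _; exact: measurable_mxtuple.
rewrite [RHS]tuple_tonelli1//; apply: eq_integral => x _.
rewrite -[RHS](ge0_integral_translate (fun i => (x * c i 0)%R))//.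
- apply: eq_integral => t _; congr f.
  rewrite mxtuple_block mxtuple1 mul1r big1 ?addr0// => j _.
  by rewrite mxE mul0r.
- apply: measurableT_comp mf _.
  by apply: measurable_cons => //; exact: measurable_id.
Qed.

Lemma linear_scaling_upper n (r : 'rV[R]_n) :
  linear_scaling (block_mx 1%:M r 0 1%:M : 'M[R]_(1 + n)).
Proof.
move=> f mf f0; rewrite det_ublock !det1 mulr1 normr1 mul1e.
rewrite [LHS]tuple_tonelli2//; last first.
  by apply: measurableT_comp mf _; exact: measurable_mxtuple.
rewrite [RHS]tuple_tonelli2//; apply: eq_integral => t _.
rewrite -[RHS](@ge0_integral_affine _ 1%R (\sum_j r 0 j * tnth t j)%R)//.
- rewrite normr1 mul1e; apply: eq_integral => x _; congr f.
  rewrite mxtuple_block mxtuple1; congr (tcons (_, _)).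
  by apply: eq_from_tnth => i; rewrite tnth_mktuple mxE mulr0 addr0.
- apply: measurableT_comp mf _.
  by apply: measurable_cons => //; exact: measurable_id.
Qed.

Lemma linear_scaling_diag n (b : R) (D : 'M[R]_n) : b != 0%R ->
  linear_scaling D -> linear_scaling (block_mx b%:M 0 0 D : 'M[R]_(1 + n)).
Proof.
move=> b0 sD f mf f0; rewrite det_ublock det_scalar1 normrM EFinM.
have mfb : measurable_fun setT (f \o mxtuple (block_mx b%:M 0 0 D)).
  by apply: measurableT_comp mf _; exact: measurable_mxtuple.
rewrite [X in _ * X]tuple_tonelli1//.
rewrite [RHS]tuple_tonelli1//.
have mF : measurable_fun setT (fun x => \int[tuple_measure mu n]_t f (tcons (x, t))).
  apply: (measurable_fun_fubini_tonelli_F (m2 := tuple_measure mu n)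
    (fun p => f (tcons p))) => //.
  exact: measurableT_comp mf (@measurable_tcons _ _ n).
rewrite -[RHS](@ge0_integral_affine _ b 0%R)//; last first.
  by move=> x; exact: integral_ge0.
rewrite -muleA -ge0_integralZl//; last 2 first.
- apply: (measurable_fun_fubini_tonelli_F (m2 := tuple_measure mu n)
    (fun p => (f \o mxtuple (block_mx b%:M 0 0 D)) (tcons p))) => //.
    exact: measurableT_comp mfb (@measurable_tcons _ _ n).
  by move=> p; exact: f0.
- by move=> x _; exact: integral_ge0.
congr (_ * _); apply: eq_integral => x _.
rewrite -[RHS]sD//; last first.
  apply: measurableT_comp mf _.
  by apply: measurable_cons => //; exact: measurable_id.
congr (_ * _); apply: eq_integral => t _; congr f.
rewrite mxtuple_block; congr (tcons (_, _)).
  by congr (_ + _)%R; rewrite big1// => j _; rewrite mxE mul0r.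
by apply: eq_from_tnth => i; rewrite tnth_mktuple mxE mulr0 addr0.
Qed.

End linear_change.

Section linear_change_unit.
Context {R : realType}.
Local Notation mu := (@lebesgue_measure R).

(** Induction on the dimension through a block factorization
    lower * diagonal * upper, each factor of which is handled by Tonelli's
    theorem. This needs a nonzero pivot in the upper left corner. *)
Lemma linear_scaling_unit n (B : 'M[R]_n) : B \in unitmx -> linear_scaling B.
Proof.
elim: n B => [|n IH] B.
  move=> _ f mf f0; rewrite det_mx00 normr1 mul1e.
  by apply: eq_integral => t _; congr f; rewrite [RHS]tuple0 [LHS]tuple0.
have pivot (M : 'M[R]_(1 + n)) : M \in unitmx -> ulsubmx M 0 0 != 0%R ->
    linear_scaling M.
  move=> Mu; set b := ulsubmx M 0 0 => b0.
  pose c := dlsubmx M; pose r := ursubmx M; pose D := drsubmx M.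
  pose D' := D - b^-1 *: (c *m r).
  have ME : M = block_mx 1%:M 0 (b^-1 *: c) 1%:M *m block_mx b%:M 0 0 D' *m
                block_mx 1%:M (b^-1 *: r) 0 1%:M.
    rewrite !mulmx_block !(mul1mx, mulmx1, mul0mx, mulmx0, addr0, add0r).
    rewrite -[LHS]submxK [ulsubmx M]mx11_scalar -/b; congr block_mx.
    - by rewrite mul_scalar_mx scalerA mulfV// scale1r.
    - by rewrite mul_mx_scalar scalerA mulfV// scale1r.
    - rewrite mul_mx_scalar scalerA mulfV// scale1r -scalemxAr /D'.
      by rewrite addrC subrK.
  have D'u : D' \in unitmx.
    move: Mu; rewrite ME !unitmxE !det_mulmx det_lblock !det_ublock !det1.
    by rewrite !mul1r mulr1 !unitfE mulf_eq0 negb_or => /andP[].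
  rewrite ME; apply: linear_scaling_mul; last exact: linear_scaling_upper.
  apply: linear_scaling_mul; first exact: linear_scaling_lower.
  by apply: linear_scaling_diag => //; exact: IH.
(* If the corner vanishes, multiplying by an upper shear built from the first
   column c puts the sum of the squares of c in the corner; this is nonzero, for
   otherwise the whole first column would vanish. *)
move=> Bu; have [b0|] := eqVneq (ulsubmx (B : 'M[R]_(1 + n)) 0 0) 0%R; last exact: pivot.
pose M : 'M[R]_(1 + n) := B.
pose c := dlsubmx M.
pose U : 'M[R]_(1 + n) := block_mx 1%:M c^T 0 1%:M.
pose V : 'M[R]_(1 + n) := block_mx 1%:M (- c^T) 0 1%:M.
have VU : V *m U = 1%:M.
  rewrite /V /U mulmx_block !(mul1mx, mulmx1, mul0mx, mulmx0, addr0, add0r).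
  by rewrite subrr -scalar_mx_block.
have UMu : U *m M \in unitmx.
  by rewrite unitmx_mul Bu andbT /U unitmxE det_ublock !det1 mulr1 unitr1.
rewrite -[B]/M -[M]mul1mx -VU -mulmxA.
apply: linear_scaling_mul; first exact: linear_scaling_upper.
apply: pivot => //.
have M0 : M = block_mx 0 (ursubmx M) c (drsubmx M).
  by rewrite -[LHS]submxK [ulsubmx M]mx11_scalar b0 raddf0.
rewrite [X in U *m X]M0 /U mulmx_block block_mxKul mul1mx add0r.
rewrite mxE; under eq_bigr => i _ do rewrite mxE -expr2.
rewrite psumr_eq0 => [|i _]; last exact: sqr_ge0.
apply/negP => /allP c0.
have c00 : c = 0.
  apply/colP => i; rewrite [RHS]mxE; apply/eqP.
  by have := c0 i (mem_index_enum i); rewrite /= sqrf_eq0.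
have : M \in unitmx by exact: Bu.
rewrite M0 c00 unitmxE det_ublock det_mx11 mxE mul0r.
by rewrite unitr0.
Qed.

Lemma Rintegral_linear n (B : 'M[R]_n) (f : n.-tuple R -> R) : B \in unitmx ->
  (tuple_measure mu n).-integrable setT (EFin \o f) ->
  `|\det B| * \int[tuple_measure mu n]_t f (mxtuple B t) =
  \int[tuple_measure mu n]_t f t.
Proof.
move=> Bu; apply: (@Rintegral_change _ _ _ (tuple_measure mu n) (mxtuple B)).
- exact: measurable_mxtuple.
- by rewrite normr_gt0 -unitfE -unitmxE.
- by move=> g mg g0; exact: linear_scaling_unit.
Qed.

Lemma integrable_linear n (B : 'M[R]_n) (f : n.-tuple R -> R) : B \in unitmx ->
  (tuple_measure mu n).-integrable setT (EFin \o f) ->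
  (tuple_measure mu n).-integrable setT (EFin \o (f \o mxtuple B)).
Proof.
move=> Bu; apply: (@integrable_change _ _ _ (tuple_measure mu n) (mxtuple B) `|\det B|).
- exact: measurable_mxtuple.
- by rewrite normr_gt0 -unitfE -unitmxE.
- by move=> g mg g0; exact: linear_scaling_unit.
Qed.
End linear_change_unit.

(** * The Fejer kernel *)

Section fejer.
Context {R : realType}.
Local Notation mu := (@lebesgue_measure R).

Lemma Rintegral_FTC (f F : R -> R) (a b : R) : a <= b ->
  continuous f -> (forall x : R, is_derive x 1 F (f x)) ->
  \int[mu]_(x in `[a, b]) f x = F b - F a.
Proof.
move=> ab cf dF.
have [->|anb] := eqVneq a b.
  by rewrite set_itv1 Rintegral_set1 subrr.
have altb : a < b by rewrite lt_neqAle anb.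
have cF : continuous F.
  move=> x; apply: differentiable_continuous.
  by apply/derivable1_diffP; have [] := dF x.
rewrite /Rintegral (@continuous_FTC2 _ f F)//.
- exact: continuous_subspaceT.
- split.
  + by move=> x _; have [] := dF x.
  + exact/cvg_at_right_filter/cF.
  + exact/cvg_at_left_filter/cF.
- by move=> x _; rewrite derive1E; apply: derive_val.
Qed.

Lemma continuous_cos_mul (th : R) : continuous (fun x : R => cos (th * x)).
Proof.
move=> x; apply: (@continuous_comp _ _ _ (fun x => th * x) (@cos R)).
  exact: mulrl_continuous.
exact: continuous_cos.
Qed.

Lemma Rintegral_cos_mul (th a b : R) : a <= b -> th != 0 ->
  \int[mu]_(x in `[a, b]) cos (th * x) = (sin (th * b) - sin (th * a)) / th.
Proof.
move=> ab th0.
have dF (x : R) : is_derive x 1 (fun x => th^-1 * sin (th * x)) (cos (th * x)).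
  apply: is_derive_eq.
  by rewrite /GRing.scale/= mulr1 mulrCA mulVf// mulr1.
rewrite (Rintegral_FTC ab (@continuous_cos_mul th) dF); ring.
Qed.

(** Half-open, so that the cells of all the integers partition the line. *)
Definition cell (n : int) : set R := `[n%:~R - 2^-1, n%:~R + 2^-1[%classic.

(** The squared modulus of the geometric sum of exp (2 i pi j y) over j < N,
    divided by N. *)
Definition fejer (N : nat) (y : R) : R := N%:R^-1 *
  ((\sum_(j < N) cos (2 * pi * j%:R * y)) ^+ 2 +
   (\sum_(j < N) sin (2 * pi * j%:R * y)) ^+ 2).

Lemma fejer_ge0 N y : 0 <= fejer N y.
Proof. by rewrite mulr_ge0 ?invr_ge0// addr_ge0// sqr_ge0. Qed.

Lemma sqr_sum_cos_sin (I : finType) (a : I -> R) :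
  (\sum_i cos (a i)) ^+ 2 + (\sum_i sin (a i)) ^+ 2 =
  \sum_i \sum_j cos (a i - a j).
Proof.
rewrite !expr2 !mulr_suml -big_split; apply: eq_bigr => i _ /=.
rewrite !mulr_sumr -big_split; apply: eq_bigr => j _ /=.
by rewrite cosB.
Qed.

Lemma fejerE N y : fejer N y =
  N%:R^-1 * \sum_(j < N) \sum_(l < N) cos (2 * pi * (j%:R - l%:R) * y).
Proof.
rewrite /fejer sqr_sum_cos_sin; congr (_ * _).
apply: eq_bigr => j _; apply: eq_bigr => l _; congr cos; ring.
Qed.

(** Multiplying the geometric sum by exp (2 i pi y) - 1 makes it telescope. The
    squared moduli of both sides, divided by 2 N, are the two sides here. *)
Lemma fejer_gap N y : (1 - cos (2 * pi * y)) * fejer N y =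
  N%:R^-1 * (1 - cos (2 * pi * N%:R * y)).
Proof.
rewrite mulrCA; congr (_ * _).
set C := \sum_(j < N) _; set S := \sum_(j < N) _.
set th := 2 * pi * y.
(* The real and imaginary parts of the telescoping identity. *)
have telC : (1 - cos th) * C + sin th * S = 1 - cos (2 * pi * N%:R * y).
  rewrite /C /S {C S}; elim: N => [|N IH].
    by rewrite !big_ord0 !(mulr0, mul0r) cos0; ring.
  rewrite !big_ord_recr/=; set cN := cos (_ * N%:R * _); set sN := sin (_ * N%:R * _).
  rewrite [LHS](_ : _ =
    ((1 - cos th) * \sum_(j < N) cos (2 * pi * j%:R * y) +
      sin th * \sum_(j < N) sin (2 * pi * j%:R * y)) +
    ((1 - cos th) * cN + sin th * sN)); last by ring.
  rewrite {}IH.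
  have -> : 2 * pi * N.+1%:R * y = 2 * pi * N%:R * y + th by rewrite /th -natr1; ring.
  by rewrite cosD /cN /sN; ring.
have telS : (1 - cos th) * S - sin th * C = - sin (2 * pi * N%:R * y).
  rewrite /C /S {telC C S}; elim: N => [|N IH].
    by rewrite !big_ord0 !(mulr0, mul0r) sin0; ring.
  rewrite !big_ord_recr/=; set cN := cos (_ * N%:R * _); set sN := sin (_ * N%:R * _).
  rewrite [LHS](_ : _ =
    ((1 - cos th) * \sum_(j < N) sin (2 * pi * j%:R * y) -
      sin th * \sum_(j < N) cos (2 * pi * j%:R * y)) +
    ((1 - cos th) * sN - sin th * cN)); last by ring.
  rewrite {}IH.
  have -> : 2 * pi * N.+1%:R * y = 2 * pi * N%:R * y + th by rewrite /th -natr1; ring.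
  by rewrite sinD /cN /sN; ring.
have key : ((1 - cos th) ^+ 2 + sin th ^+ 2) * (C ^+ 2 + S ^+ 2) =
    (1 - cos (2 * pi * N%:R * y)) ^+ 2 + sin (2 * pi * N%:R * y) ^+ 2.
  rewrite -[sin (_ * y)]opprK -telC -telS; ring.
have := key; rewrite !sin2cos2 => key2.
apply: (@mulfI _ 2) => //; lra.
Qed.

Lemma measurable_fejer N : measurable_fun setT (fejer N).
Proof.
rewrite (_ : fejer N = fun y => N%:R^-1 *
  \sum_(j < N) \sum_(l < N) cos (2 * pi * (j%:R - l%:R) * y)); last first.
  by apply/funext => y; rewrite fejerE.
apply: measurable_funM => //; apply: measurable_sum => j; apply: measurable_sum => l.
by apply: continuous_measurable_fun; exact: continuous_cos_mul.
Qed.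

Lemma fejer_le N y : fejer N y <= N%:R.
Proof.
case: N => [|N]; first by rewrite /fejer invr0 mul0r.
rewrite fejerE ler_pdivrMl// -natrM.
rewrite (le_trans (ler_sum _ (fun i _ => ler_sum _ (fun j _ => cos_le1 _))))//.
by rewrite !sumr_const !card_ord -mulrnA.
Qed.

Lemma integrable_cell n (h : R -> R) (M : R) : measurable_fun setT h ->
  (forall x, `|h x| <= M) ->
  mu.-integrable setT (EFin \o (fun y => \1_(cell n) y * h y)).
Proof.
move=> mh hM; apply: (@integrable_mul_bounded _ _ _ mu (\1_(cell n)) h M) => //.
exact: integrable_indic_itv.
Qed.

Lemma Rintegral_indic_mul (A : set R) (f : R -> R) :
  \int[mu]_x (\1_A x * f x) = \int[mu]_(x in A) f x.
Proof.
by rewrite [RHS]Rintegral_mkcond patch_indic; apply: eq_Rintegral => x _; rewrite mulrC.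
Qed.

Lemma integrable_cos_itv (th : R) (i : interval R) (a b : R) : [set` i] `<=` `[a, b] ->
  mu.-integrable [set` i] (EFin \o (fun y => cos (th * y))).
Proof.
move=> iab.
have : mu.-integrable `[a, b] (EFin \o (fun y => cos (th * y))).
  apply: continuous_compact_integrable; first exact: segment_compact.
  exact/continuous_subspaceT/continuous_cos_mul.
by apply: integrableS => //; exact: measurable_itv.
Qed.

Lemma periodicz (f : R -> R) (T : R) : periodic f T ->
  forall (m : int) x, f (x + T * m%:~R) = f x.
Proof.
move=> fT [m|m] x; first by rewrite mulr_natr periodicn.
rewrite NegzE mulrNz mulrN -[X in _ = f X](subrK (T * m.+1%:~R)).
by rewrite mulr_natr periodicn.
Qed.

Lemma sinD2piz x (m : int) : sin (x + 2 * pi * m%:~R) = sin x :> R.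
Proof. rewrite mulr_natl; exact: (periodicz (@sinD2pi R)). Qed.

Lemma cosD2piz x (m : int) : cos (x + 2 * pi * m%:~R) = cos x :> R.
Proof. rewrite mulr_natl; exact: (periodicz (@cosD2pi R)). Qed.

Lemma Rintegral_cell_cos n (m : int) :
  \int[mu]_y (\1_(cell n) y * cos (2 * pi * m%:~R * y)) = (m == 0)%:R.
Proof.
rewrite Rintegral_indic_mul /cell Rintegral_itv_bndo_bndc; last first.
  by apply: (@integrable_cos_itv _ _ (n%:~R - 2^-1) (n%:~R + 2^-1)); exact: subset_itv_co_cc.
have [->|m0] := eqVneq m 0.
  under eq_Rintegral do rewrite mulr0 mul0r cos0.
  rewrite Rintegral_cst//= lebesgue_measure_itv/= lte_fin ifT; last by lra.
  by rewrite /= mul1r; lra.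
rewrite Rintegral_cos_mul; [|lra|].
  rewrite (_ : 2 * pi * m%:~R * (n%:~R + 2^-1) =
    2 * pi * m%:~R * (n%:~R - 2^-1) + 2 * pi * m%:~R); last by field.
  by rewrite sinD2piz subrr mul0r.
by rewrite !mulf_neq0 ?pnatr_eq0 ?intr_eq0// gt_eqF// pi_gt0.
Qed.

Lemma integrable_cell_cos n (th : R) :
  mu.-integrable setT (EFin \o (fun y => \1_(cell n) y * cos (th * y))).
Proof.
apply: (@integrable_cell n _ 1); last by move=> x; exact: cos_max.
by apply: continuous_measurable_fun; exact: continuous_cos_mul.
Qed.

Lemma integrable_cell_fejer n N :
  mu.-integrable setT (EFin \o (fun y => \1_(cell n) y * fejer N y)).
Proof.
apply: (@integrable_cell n _ N%:R); first exact: measurable_fejer.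
by move=> x; rewrite ger0_norm ?fejer_ge0// fejer_le.
Qed.

Lemma Rintegral_cell_fejer n N :
  \int[mu]_y (\1_(cell n) y * fejer N.+1 y) = 1.
Proof.
have E y : \1_(cell n) y * fejer N.+1 y = N.+1%:R^-1 * \sum_(j < N.+1)
    \sum_(l < N.+1) (\1_(cell n) y * cos (2 * pi * (j%:Z - l%:Z)%:~R * y)).
  rewrite fejerE mulrCA; congr (_ * _); rewrite mulr_sumr.
  apply: eq_bigr => j _; rewrite mulr_sumr; apply: eq_bigr => l _.
  by rewrite intrB.
under eq_Rintegral => y _ do rewrite E.
have ic j l := @integrable_cell_cos n (2 * pi * (j%:Z - l%:Z)%:~R).
have ics j : mu.-integrable setT (EFin \o (fun y => 
    \sum_(l < N.+1) (\1_(cell n) y * cos (2 * pi * (j%:Z - l%:Z)%:~R * y)))).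
  by apply: integrable_sumr => l _; exact: ic.
rewrite RintegralZl//; last by apply: integrable_sumr => j _; exact: ics.
rewrite Rintegral_sumr; last by move=> j _; exact: ics.
rewrite (eq_bigr (fun=> 1)) => [|j _].
  by rewrite sumr_const card_ord mulVf// pnatr_eq0.
rewrite Rintegral_sumr; last by move=> l _; exact: ic.
rewrite (bigD1 j)//= Rintegral_cell_cos subrr eqxx big1 ?addr0// => l lj.
rewrite Rintegral_cell_cos subr_eq0 eqz_nat eq_sym.
by have /negbTE := lj; rewrite -val_eqE /= => ->.
Qed.
End fejer.

Section fejer_product.
Context {R : realType}.
Import complex.
Let cx := complex.complex R.
Let cis (t : R) : cx := complex.Complex (cos t) (sin t).
Let nsq (z : cx) : R := complex.Re z ^+ 2 + complex.Im z ^+ 2.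

Let cisD x y : cis (x + y) = cis x * cis y.
Proof. by rewrite /cis cosD sinD; congr complex.Complex; ring. Qed.

Let cis0 : cis 0 = 1.
Proof. by rewrite /cis cos0 sin0. Qed.

Let nsqM z1 z2 : nsq (z1 * z2) = nsq z1 * nsq z2.
Proof. by case: z1 => a b; case: z2 => c d; rewrite /nsq /=; ring. Qed.

Let nsq1 : nsq 1 = 1.
Proof. by rewrite /nsq /=; ring. Qed.

Let nsq_sum_cis (I : finType) (a : I -> R) :
  nsq (\sum_i cis (a i)) = \sum_i \sum_j cos (a i - a j).
Proof.
rewrite -sqr_sum_cos_sin /nsq; congr (_ ^+ 2 + _ ^+ 2).
  by apply: (big_morph (@complex.Re R) (id1 := 0) (op1 := +%R)) => // -[? ?] [? ?].
by apply: (big_morph (@complex.Im R) (id1 := 0) (op1 := +%R)) => // -[? ?] [? ?].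
Qed.

(** The product of the geometric sums is again a sum of exponentials, now over
    vectors of indices. Complex numbers serve to expand this product; its squared
    modulus is then a double sum of cosines. *)
Lemma prod_fejer d N (t : 'I_d -> R) : \prod_i fejer N (t i) =
  N%:R ^- d * \sum_(j : {ffun 'I_d -> 'I_N}) \sum_(l : {ffun 'I_d -> 'I_N})
    cos (\sum_i 2 * pi * ((j i)%:R - (l i)%:R) * t i).
Proof.
have E y : fejer N y = N%:R^-1 * nsq (\sum_(j < N) cis (2 * pi * j%:R * y)).
  by rewrite nsq_sum_cis /fejer sqr_sum_cos_sin.
under eq_bigr => i _ do rewrite E.
rewrite big_split/= prodr_const card_ord exprVn; congr (_ * _).
rewrite -(big_morph nsq nsqM nsq1) bigA_distr_bigA/=.
under eq_bigr => j _ do rewrite -(big_morph cis cisD cis0).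
rewrite nsq_sum_cis; apply: eq_bigr => j _; apply: eq_bigr => l _.
by congr cos; rewrite -sumrB; apply: eq_bigr => i _; ring.
Qed.
End fejer_product.

(** * Sampling at the integer points *)

Section sampling.
Context {R : realType}.
Local Notation mu := (@lebesgue_measure R).

(** On the cell of n, either y is within e of n, or 1 - cos (2 pi y) is at least
    its value at e, while |y - n| is at most 1. The right hand side has, thanks
    to [fejer_gap], a small integral against the Fejer kernel. *)
Lemma gap_bound (e y : R) (n : int) : 0 < e <= 2^-1 -> cell n y ->
  `|y - n%:~R| <= e + (1 - cos (2 * pi * e))^-1 * (1 - cos (2 * pi * y)).
Proof.
move=> /andP[e0 e2]; rewrite /cell/= in_itv/= => /andP[ny yn].
have pi0 := pi_gt0 R.
have sE : cos (2 * pi * y) = cos (2 * pi * `|y - n%:~R|).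
  rewrite -[y in LHS](subrK n%:~R) mulrDr cosD2piz -[LHS]cos_norm normrM.
  by rewrite ger0_norm// mulr_ge0// ltW.
have s2 : `|y - n%:~R| <= 2^-1 by rewrite ler_norml; apply/andP; split; lra.
rewrite {}sE; set s : R := `|y - n%:~R| in s2 *; have s0 : 0 <= s by exact: normr_ge0.
have in0pi (x : R) : 0 <= x <= 2^-1 -> 2 * pi * x \in `[0, pi : R].
  move=> /andP[x0 x2]; rewrite in_itv/= -mulrA mulrCA.
  by apply/andP; split; nra.
have cose : cos (2 * pi * e) < 1.
  rewrite -[X in _ < X]cos0 ltr_cos.
  - by rewrite pmulr_rgt0// mulr_gt0.
  - by rewrite in_itv/= lexx ltW.
  - by apply: in0pi; apply/andP; split; lra.
have c0 : 0 <= (1 - cos (2 * pi * e))^-1 by rewrite invr_ge0; lra.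
have [se|es] := leP s e.
  by rewrite ler_wpDr// mulr_ge0// subr_ge0 cos_le1.
apply: (@le_trans _ _ 1); first by lra.
rewrite -[leLHS]add0r; apply: lerD; first exact: ltW.
rewrite mulrC ler_pdivlMr; last by lra.
rewrite mul1r lerB//; apply: ltW; rewrite ltr_cos.
- by rewrite ltr_pM2l// mulr_gt0.
- by apply: in0pi; apply/andP; split; lra.
- by apply: in0pi; apply/andP; split; lra.
Qed.

Lemma sum_cell (M : nat) (y : R) : `|y| <= M%:R ->
  \sum_(k < M.*2.+1) \1_(cell (k%:Z - M%:Z)) y = 1 :> R.
Proof.
rewrite ler_norml => /andP[My yM].
pose f := Num.floor (y + 2^-1).
have [f1 f2] : f%:~R <= y + 2^-1 /\ y + 2^-1 < f%:~R + 1.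
  by have /andP[] := floor_itv (y + 2^-1); rewrite intrD.
have inE n : (y \in cell n) = (n == f).
  apply/idP/eqP => [|->].
    rewrite inE /cell/= in_itv/= => /andP[a b].
    apply/le_anti/andP; split; rewrite -ltzD1 -(ltr_int R) intrD; lra.
  by rewrite inE /cell/= in_itv/=; apply/andP; split; lra.
have fM : 0 <= f + M%:Z.
  by rewrite -ltzD1 -(ltr_int R) !intrD -pmulrn; lra.
have fM2 : f + M%:Z < M.*2.+1%:Z.
  rewrite -(ltr_int R) intrD -[X in _ < X]pmulrn -addn1 natrD -addnn natrD -pmulrn; lra.
have kM : (`|(f + M%:Z)%R| < M.*2.+1)%N by rewrite -ltz_nat gez0_abs.
rewrite (bigD1 (Ordinal kM))//= big1 ?addr0 => [|k].
  by rewrite indicE inE gez0_abs// addrK eqxx.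
rewrite -val_eqE/= => kf; rewrite indicE inE subr_eq.
case: eqP => // kE; move: kf; rewrite -kE.
by rewrite absz_nat eqxx.
Qed.
End sampling.

Section fejer_sampling.
Context {R : realType}.
Local Notation mu := (@lebesgue_measure R).

Definition grid_point (M : nat) d (n : {ffun 'I_d -> 'I_M.*2.+1}) : 'cV[int]_d :=
  \col_i ((n i)%:Z - M%:Z).

Definition int_tuple d (m : 'cV[int]_d) : d.-tuple R :=
  [tuple (m i 0)%:~R | i < d].

Lemma grid_cells M d (t : d.-tuple R) : (forall i, `|tnth t i| <= M%:R) ->
  \sum_(n : {ffun 'I_d -> 'I_M.*2.+1})
    \prod_i \1_(cell (grid_point n i 0)) (tnth t i) = 1 :> R.
Proof.
move=> tM; under eq_bigr => n _ do under eq_bigr => i _ do rewrite mxE.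
rewrite -(bigA_distr_bigA (fun i (k : 'I_M.*2.+1) =>
  \1_(cell (k%:Z - M%:Z)) (tnth t i))).
by apply: big1 => i _; exact: sum_cell.
Qed.

Let cellfejer N n y : R := \1_(cell n) y * fejer N.+1 y.

Lemma fejer_gap_le N (y : R) : (1 - cos (2 * pi * y)) * fejer N.+1 y <= 2 / N.+1%:R.
Proof.
rewrite fejer_gap mulrC ler_pM2r ?invr_gt0//.
by have := cos_geN1 (2 * pi * N.+1%:R * y); lra.
Qed.

(** On the cell around an integer point, the product of Fejer kernels is a
    probability density. By the Lipschitz condition, the distance from its average
    of phi to the value at the centre is controlled by the first moments of the
    kernel, which [gap_bound] estimates. *)
Lemma fejer_sampling_cell d (phi : d.-tuple R -> R) (L H : R) (n : 'cV[int]_d)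
    (e : R) N : 0 < e <= 2^-1 ->
  measurable_fun setT phi -> (forall t, `|phi t| <= H) -> 0 <= L ->
  (forall s t, `|phi s - phi t| <= L * \sum_i `|tnth s i - tnth t i|) ->
  let P := fun t : d.-tuple R => \prod_i (\1_(cell (n i 0)) (tnth t i) * fejer N.+1 (tnth t i)) in
  (tuple_measure mu d).-integrable setT (EFin \o (fun t => P t * phi t)) /\
  `|\int[tuple_measure mu d]_t (P t * phi t) - phi (int_tuple n)| <=
    L * d%:R * (e + 2 * (1 - cos (2 * pi * e))^-1 / N.+1%:R).
Proof.
move=> e0 mphi phiH L0 phiL P.
set C := (1 - cos (2 * pi * e))^-1.
have Pi : (tuple_measure mu d).-integrable setT (EFin \o P).
  apply: (integrable_tuple_prod (mu := mu) (f := fun i => cellfejer N (n i 0))) => i.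
  exact: integrable_cell_fejer.
have P1 : \int[tuple_measure mu d]_t P t = 1.
  rewrite (Rintegral_tuple_prod (mu := mu) (f := fun i => cellfejer N (n i 0))).
    by apply: big1 => i _; exact: Rintegral_cell_fejer.
  by move=> i; exact: integrable_cell_fejer.
have P0 t : 0 <= P t.
  by apply: prodr_ge0 => i _; rewrite mulr_ge0// ?fejer_ge0// indicE.
have Pphii : (tuple_measure mu d).-integrable setT (EFin \o (fun t => P t * phi t)).
  exact: (integrable_mul_bounded (M := H)).
split => //.
(* Q i is P with the i-th kernel replaced by the bound of [fejer_gap_le] for its
   product with the gap function. *)
pose Q (i : 'I_d) (t : d.-tuple R) : R := \prod_k (\1_(cell (n k 0)) (tnth t k) *
   (if k == i then 2 / N.+1%:R else fejer N.+1 (tnth t k))).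
have Qfi i k : mu.-integrable setT (EFin \o (fun y => \1_(cell (n k 0)) y *
    (if k == i then 2 / N.+1%:R else fejer N.+1 y))).
  case: (k == i); last exact: integrable_cell_fejer.
  by apply: (@integrable_cell _ _ _ (2 / N.+1%:R)) => // x; rewrite ger0_norm.
have Qi i : (tuple_measure mu d).-integrable setT (EFin \o Q i).
  exact: (integrable_tuple_prod (mu := mu) (Qfi i)).
have Q1 i : \int[tuple_measure mu d]_t Q i t = 2 / N.+1%:R.
  rewrite (Rintegral_tuple_prod (mu := mu) (Qfi i)).
  rewrite (bigD1 i)//= eqxx big1 ?mulr1.
    have i1 : mu.-integrable setT (EFin \o (\1_(cell (n i 0)) : R -> R)).
      exact: integrable_indic_itv.
    rewrite RintegralZr//; have := @Rintegral_cell_cos R (n i 0) 0.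
    rewrite eqxx => ci; rewrite [X in X * _](_ : _ = 1) ?mul1r// -[RHS]ci.
    by apply: eq_Rintegral => x _; rewrite mulr0 mul0r cos0 mulr1.
  by move=> k /negbTE ->; exact: Rintegral_cell_fejer.
have PQ t i : P t * `|tnth t i - tnth (int_tuple n) i| <= e * P t + C * Q i t.
  rewrite [P t](bigD1 i)//= [Q i t](bigD1 i)//= eqxx.
  rewrite [X in _ <= _ + C * (_ * X)](_ : _ = \prod_(k < d | k != i)
    (\1_(cell (n k 0)) (tnth t k) * fejer N.+1 (tnth t k))); last first.
    by apply: eq_bigr => k /negbTE ->.
  set W := \prod_(k < d | _) _; have W0 : 0 <= W.
    by apply: prodr_ge0 => k _; rewrite mulr_ge0// ?fejer_ge0// indicE.
  rewrite tnth_mktuple !indicE.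
  case: (boolP (tnth t i \in cell (n i 0))); last by rewrite !mul0r !mulr0 addr0.
  rewrite inE => /(gap_bound e0); rewrite -/C !mul1r => gb.
  have F0 : 0 <= fejer N.+1 (tnth t i) by exact: fejer_ge0.
  have C0 : 0 <= C by rewrite invr_ge0 subr_ge0 cos_le1.
  apply: le_trans (_ : fejer N.+1 (tnth t i) * W *
    (e + C * (1 - cos (2 * pi * tnth t i))) <= _).
    by rewrite ler_wpM2l// mulr_ge0.
  rewrite mulrDr [leLHS]addrC [leRHS]addrC lerD//; last by rewrite mulrC.
  rewrite [leLHS](_ : _ =
    C * ((1 - cos (2 * pi * tnth t i)) * fejer N.+1 (tnth t i) * W)); last by ring.
  by apply: ler_wpM2l => //; apply: ler_wpM2r => //; exact: fejer_gap_le.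
have Pci : (tuple_measure mu d).-integrable setT
    (EFin \o (fun t => P t * phi (int_tuple n))).
  by apply: (integrable_mul_bounded (M := `|phi (int_tuple n)|)).
rewrite -[phi (int_tuple n)]mul1r -[X in _ - X * _]P1 -RintegralZr// -RintegralB//.
have Gi i : (tuple_measure mu d).-integrable setT
    (EFin \o (fun t => e * P t + C * Q i t)).
  by apply: integrable_add; exact: integrable_scale.
have Di : (tuple_measure mu d).-integrable setT
    (EFin \o (fun t => P t * phi t - P t * phi (int_tuple n))).
  exact: integrable_sub.
apply: (le_trans (le_normr_Rintegral _ _)) => //.
apply: (@le_trans _ _ (\int[tuple_measure mu d]_t
    (L * \sum_i (e * P t + C * Q i t)))).
  apply: le_Rintegral => //.
  - exact: integrable_abse Di.
  - by apply: integrable_scale; exact: integrable_sumr.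
  - move=> t _; rewrite -mulrBr normrM (ger0_norm (P0 t)).
    rewrite (le_trans (ler_wpM2l (P0 t) (phiL _ _)))// mulrCA ler_wpM2l// mulr_sumr.
    by apply: ler_sum => i _; exact: PQ.
rewrite RintegralZl//; last exact: integrable_sumr.
rewrite Rintegral_sumr// -mulrA ler_wpM2l//.
rewrite (eq_bigr (fun=> e + 2 * C / N.+1%:R)) => [|i _].
  by rewrite sumr_const card_ord -[leLHS]mulr_natl.
rewrite RintegralD//; [|exact: integrable_scale|exact: integrable_scale].
by rewrite !RintegralZl// P1 Q1 mulr1 mulrA [C * 2]mulrC.
Qed.
End fejer_sampling.

Section poisson.
Context {R : realType}.
Local Notation mu := (@lebesgue_measure R).

(** The cells around the integer points of the grid cover the support of phi, so
    the estimates on single cells add up. *)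
Lemma fejer_sampling M d (phi : d.-tuple R -> R) (L H : R) :
  measurable_fun setT phi -> (forall t, `|phi t| <= H) -> 0 <= L ->
  (forall s t, `|phi s - phi t| <= L * \sum_i `|tnth s i - tnth t i|) ->
  (forall t, phi t != 0 -> forall i, `|tnth t i| <= M%:R) ->
  (forall N, (tuple_measure mu d).-integrable setT
      (EFin \o (fun t => phi t * \prod_i fejer N.+1 (tnth t i)))) /\
  forall e : R, 0 < e -> exists N,
   `|\int[tuple_measure mu d]_t (phi t * \prod_i fejer N.+1 (tnth t i)) -
     \sum_(n : {ffun 'I_d -> 'I_M.*2.+1}) phi (int_tuple (grid_point n))| <= e.
Proof.
move=> mphi phiH L0 phiL phiM.
pose P N (n : 'cV[int]_d) (t : d.-tuple R) : R :=
  \prod_i (\1_(cell (n i 0)) (tnth t i) * fejer N.+1 (tnth t i)).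
have E N t : phi t * \prod_i fejer N.+1 (tnth t i) =
   \sum_(n : {ffun 'I_d -> 'I_M.*2.+1}) P N (grid_point n) t * phi t.
  have PE n : P N n t = (\prod_i \1_(cell (n i 0)) (tnth t i)) *
      \prod_i fejer N.+1 (tnth t i) by rewrite /P big_split.
  under [RHS]eq_bigr => n _ do rewrite PE -mulrA.
  rewrite -mulr_suml; have [->|p0] := eqVneq (phi t) 0; first by rewrite mul0r !mulr0.
  by rewrite (grid_cells (phiM t p0)) mul1r mulrC.
have h0 : 0 < (2^-1 : R) <= 2^-1 by rewrite lexx andbT.
have Pi N n : (tuple_measure mu d).-integrable setT (EFin \o (fun t => P N n t * phi t)).
  by have [] := fejer_sampling_cell n N h0 mphi phiH L0 phiL.
have mE N : (fun t => phi t * \prod_i fejer N.+1 (tnth t i)) =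
   (fun t => \sum_(n : {ffun 'I_d -> 'I_M.*2.+1}) P N (grid_point n) t * phi t).
  by apply/funext => t; exact: E.
split=> [N|e e0].
  by rewrite mE; apply: integrable_sumr => n _; exact: Pi.
(* The number of cells times the Lipschitz factor of each; adding 1 makes it
   positive, so that it may be divided by. Each cell then has an error of at most
   L d e / K. *)
pose K : R := #|{ffun 'I_d -> 'I_M.*2.+1}|%:R * (L * d%:R) + 1.
have K0 : 0 < K by rewrite ltr_wpDl// !mulr_ge0.
pose del : R := Num.min 2^-1 (e / (2 * K)).
have del2 : 0 < del <= 2^-1.
  rewrite /del lt_min ge_min lexx /= andbT; apply/andP; split => //.
  by rewrite divr_gt0// mulr_gt0.
pose C : R := 2 * (1 - cos (2 * pi * del))^-1.
have C0 : 0 <= C by rewrite mulr_ge0// invr_ge0 subr_ge0 cos_le1.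
pose N := Num.truncn (C * (2 * K) / e).
exists N.
have CN : C / N.+1%:R <= e / (2 * K).
  rewrite ler_pdivrMr// mulrAC ler_pdivlMr ?mulr_gt0// [leRHS]mulrC -ler_pdivrMr//.
  by rewrite ltW// truncnS_gt.
rewrite (_ : Rintegral _ _ _ = \sum_(n : {ffun 'I_d -> 'I_M.*2.+1})
    \int[tuple_measure mu d]_t (P N (grid_point n) t * phi t)); last first.
  by rewrite mE Rintegral_sumr// => n _; exact: Pi.
rewrite -sumrB (le_trans (ler_norm_sum _ _ _))//.
have B (n : {ffun 'I_d -> 'I_M.*2.+1}) :
    `|\int[tuple_measure mu d]_t (P N (grid_point n) t * phi t) -
      phi (int_tuple (grid_point n))| <= L * d%:R * (e / K).
  have [_ /le_trans] := fejer_sampling_cell (grid_point n) N del2 mphi phiH L0 phiL.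
  apply; rewrite ler_wpM2l ?mulr_ge0//.
  rewrite (_ : e / K = e / (2 * K) + e / (2 * K)); last by field; exact: lt0r_neq0.
  by rewrite lerD// ge_min lexx orbT.
rewrite (le_trans (ler_sum _ (fun n _ => B n)))// sumr_const -[leLHS]mulr_natl.
rewrite [leLHS](_ : _ = (K - 1) * (e / K)); last by rewrite /K addrK; ring.
by rewrite mulrA ler_pdivrMr// mulrC ler_pM2l//; lra.
Qed.
End poisson.

(** * The error of a lattice sum *)

Section lattice_sum_error.
Context {R : realType}.
Local Notation mu := (@lebesgue_measure R).

Lemma norm_prod_le d (b : 'I_d -> R) (H : R) :
  (forall i, `|b i| <= H) -> `|\prod_i b i| <= H ^+ d.
Proof.
move=> bH; rewrite normr_prod -[X in _ ^+ X]card_ord -prodr_const.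
by apply: ler_prod => i _; rewrite normr_ge0 bH.
Qed.

Lemma prod_lipschitz d (a b : 'I_d -> R) (H : R) : 1 <= H ->
  (forall i, `|a i| <= H) -> (forall i, `|b i| <= H) ->
  `|\prod_i a i - \prod_i b i| <= H ^+ d * \sum_i `|a i - b i|.
Proof.
move=> H1; have H0 : 0 <= H by apply: le_trans H1.
elim: d a b => [|d IH] a b aH bH.
  by rewrite !big_ord0 subrr normr0 mulr0.
rewrite !big_ord_recl.
set A := \prod_i a _; set B := \prod_i b _.
have BH : `|B| <= H ^+ d.
  exact: norm_prod_le.
have -> : a ord0 * A - b ord0 * B = a ord0 * (A - B) + (a ord0 - b ord0) * B by ring.
rewrite (le_trans (ler_normD _ _))// !normrM mulrDr addrC lerD//.
  rewrite mulrC ler_wpM2r// (le_trans BH)// exprS ler_peMl// exprn_ge0//.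
rewrite exprS -mulrA ler_pM//; exact: IH.
Qed.

Lemma lipschitz_continuous (g : R -> R) (L : R) :
  (forall x y, `|g x - g y| <= L * `|x - y|) -> continuous g.
Proof.
move=> gL x; apply/cvgrPdist_le => e e0; near=> y.
have L1 : 0 < `|L| + 1 by rewrite ltr_wpDl.
rewrite (le_trans (gL x y))// (@le_trans _ _ ((`|L| + 1) * `|x - y|))//.
  by rewrite ler_wpM2r// ler_wpDr// ler_norm.
rewrite -ler_pdivlMl//.
by near: y; apply: cvgr_dist_le => //; rewrite mulr_gt0// invr_gt0.
Unshelve. all: by end_near. Qed.

Lemma integrable_bounded_supp (g : R -> R) (H S : R) : measurable_fun setT g ->
  (forall x, `|g x| <= H) -> (forall x, g x != 0 -> `|x| <= S) ->
  mu.-integrable setT (EFin \o g).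
Proof.
move=> mg gH gS.
have i1 : mu.-integrable setT (EFin \o (\1_(`[- S, S]%classic) : R -> R)).
  exact: integrable_indic_itv.
apply: eq_integrable (integrable_mul_bounded i1 mg gH) => // x _ /=.
congr EFin; have [->|/gS] := eqVneq (g x) 0; first by rewrite mulr0.
by move=> xS; rewrite indicE mem_set ?mul1r//= in_itv/= -ler_norml.
Qed.

(** Pulling back a character of the dual lattice along B gives a character of
    Z^d. *)
Lemma mxtuple_dual_phase d (B : 'M[R]_d) (m : 'cV[R]_d) (t : d.-tuple R) :
  B \in unitmx ->
  \sum_i ((invmx B)^T *m m) i 0 * tnth (mxtuple B t) i = \sum_i m i 0 * tnth t i.
Proof.
move=> Bu; pose c := \col_i tnth t i.
have E : ((invmx B)^T *m m)^T *m (B *m c) = m^T *m c.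
  by rewrite trmx_mul trmxK mulmxA -[_ *m _ *m B]mulmxA mulVmx// mulmx1.
have := congr1 (fun X : 'M[R]_1 => X 0 0) E.
rewrite mxE [RHS]mxE => {}E.
transitivity (\sum_j ((invmx B)^T *m m)^T 0 j * (B *m c) j 0).
  apply: eq_bigr => i _; rewrite [in RHS]mxE; congr (_ * _).
  by rewrite tnth_mktuple mxE; apply: eq_bigr => j _; rewrite mxE.
by rewrite E; apply: eq_bigr => i _; rewrite !mxE.
Qed.

(** Poisson summation in the form of an inequality. Expanding the Fejer kernels
    turns the smoothed lattice sum into an average over j of sums over l of
    Fourier integrals at dual points of index j - l, in which l = j gives the
    product of the integrals of the g i. The grid of radius M only has to contain
    all the integer points where the tensor product of g is nonzero. *)
Lemma lattice_sum_error d (B : 'M[R]_d) (g : 'I_d -> R -> R) (H L S D : R) (M : nat) :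
  B \in unitmx ->
  (forall i x y, `|g i x - g i y| <= L * `|x - y|) ->
  (forall i x, `|g i x| <= H) ->
  (forall i x, g i x != 0 -> `|x| <= S) ->
  (forall t : d.-tuple R, (forall i, `|tnth (mxtuple B t) i| <= S) ->
    forall i, `|tnth t i| <= M%:R) ->
  (forall N (j : {ffun 'I_d -> 'I_N.+1}),
    \sum_(l : {ffun 'I_d -> 'I_N.+1} | l != j)
     `|\int[tuple_measure mu d]_x (\prod_i g i (tnth x i) *
        cos (\sum_i (2 * pi * ((invmx B)^T *m
          (\col_k ((j k)%:R - (l k)%:R))) i 0) * tnth x i))| <= D) ->
  `| `|\det B| * \sum_(n : {ffun 'I_d -> 'I_M.*2.+1})
        \prod_i g i (tnth (mxtuple B (int_tuple (grid_point n))) i)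
     - \prod_i \int[mu]_x g i x | <= D.
Proof.
move=> Bu gL gH gS BM gD.
have gc i : continuous (g i) := lipschitz_continuous (gL i).
have mg i : measurable_fun setT (g i) by exact: continuous_measurable_fun.
have gi i : mu.-integrable setT (EFin \o g i) by exact: integrable_bounded_supp (gS i).
pose H1 := Num.max 1 H.
have gH1 i x : `|g i x| <= H1 by rewrite le_max gH orbT.
have H11 : 1 <= H1 by rewrite le_max lexx.
pose F (x : d.-tuple R) : R := \prod_i g i (tnth x i).
pose phi := F \o mxtuple B.
have mF : measurable_fun setT F.
  apply: measurable_prod => i _; apply: measurableT_comp => //.
  exact: measurable_tnth.
have mphi : measurable_fun setT phi.
  by apply: measurableT_comp => //; exact: measurable_mxtuple.
have phiH t : `|phi t| <= H1 ^+ d by exact: norm_prod_le.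
pose b : R := \sum_i \sum_j `|B i j|.
pose K := H1 ^+ d * (`|L| * b).
have K0 : 0 <= K.
  rewrite !mulr_ge0 ?exprn_ge0 ?(le_trans _ H11)//.
  by apply: sumr_ge0 => i _; apply: sumr_ge0.
have phiL s t : `|phi s - phi t| <= K * \sum_i `|tnth s i - tnth t i|.
  rewrite (le_trans (prod_lipschitz H11 _ _))// -!mulrA ler_wpM2l//.
    by rewrite exprn_ge0// (le_trans _ H11).
  rewrite /b mulr_suml mulr_sumr; apply: ler_sum => i _.
  rewrite (le_trans (gL i _ _))// (le_trans (ler_wpM2r _ (ler_norm L)))//.
  rewrite ler_wpM2l// !tnth_mktuple -sumrB (le_trans (ler_norm_sum _ _ _))//.
  rewrite mulr_suml; apply: ler_sum => j _; rewrite -mulrBr normrM ler_wpM2l//.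
  by rewrite (bigD1 j)//= lerDl sumr_ge0.
have phiM t : phi t != 0 -> forall i, `|tnth t i| <= M%:R.
  move=> pt; apply: BM => i; apply: (gS i).
  by move: pt; rewrite /phi /F /= prodf_seq_neq0 => /allP/(_ i (mem_index_enum i)).
have [fi sampling] := fejer_sampling mphi phiH K0 phiL phiM.
have B0 : 0 < `|\det B| by rewrite normr_gt0 -unitfE -unitmxE.
apply/ler_addgt0Pr => e e0.
have [|N HN] := sampling (e / `|\det B|); first by rewrite divr_gt0.
set A := Rintegral _ _ _ in HN; set Sg := \sum_n _ in HN.
rewrite -/Sg (_ : _ - _ = `|\det B| * (Sg - A) +
  (`|\det B| * A - \prod_i \int[mu]_x g i x)); last by ring.
rewrite (le_trans (ler_normD _ _))// addrC lerD//; last first.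
  by rewrite normrM normr_id mulrC -ler_pdivlMr// distrC.
pose th (j l : {ffun 'I_d -> 'I_N.+1}) (i : 'I_d) : R :=
  2 * pi * ((invmx B)^T *m (\col_k ((j k)%:R - (l k)%:R))) i 0.
pose J j l := \int[tuple_measure mu d]_x (F x * cos (\sum_i th j l i * tnth x i)).
have Ji j l : (tuple_measure mu d).-integrable setT
    (EFin \o (fun x => F x * cos (\sum_i th j l i * tnth x i))).
  by have [] := tuple_trig_prod (th j l) gi.
have phE j l t : F (mxtuple B t) * cos (\sum_i th j l i * tnth (mxtuple B t) i) =
    phi t * cos (\sum_i 2 * pi * ((j i)%:R - (l i)%:R) * tnth t i).
  congr (_ * cos _).
  under eq_bigr => i _ do rewrite -mulrA.
  rewrite -mulr_sumr mxtuple_dual_phase// mulr_sumr.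
  by apply: eq_bigr => i _; rewrite mxE; ring.
have AE : `|\det B| * A = N.+1%:R ^- d *
    \sum_(j : {ffun 'I_d -> 'I_N.+1}) \sum_(l : {ffun 'I_d -> 'I_N.+1}) J j l.
  have ci (j l : {ffun 'I_d -> 'I_N.+1}) : (tuple_measure mu d).-integrable setT (EFin \o (fun t =>
      phi t * cos (\sum_i 2 * pi * ((j i)%:R - (l i)%:R) * tnth t i))).
    apply: eq_integrable (integrable_linear Bu (Ji j l)) => // t _ /=.
    by rewrite phE.
  have -> : A = N.+1%:R ^- d * \sum_(j : {ffun 'I_d -> 'I_N.+1})
      \sum_(l : {ffun 'I_d -> 'I_N.+1}) \int[tuple_measure mu d]_t
      (phi t * cos (\sum_i 2 * pi * ((j i)%:R - (l i)%:R) * tnth t i)).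
    rewrite (eq_bigr (fun j : {ffun 'I_d -> 'I_N.+1} => \int[tuple_measure mu d]_t
      \sum_(l : {ffun 'I_d -> 'I_N.+1})
      (phi t * cos (\sum_i 2 * pi * ((j i)%:R - (l i)%:R) * tnth t i)))); last first.
      by move=> j _; rewrite Rintegral_sumr// => l _; exact: ci.
    rewrite -Rintegral_sumr => [|j _]; last exact: integrable_sumr.
    rewrite -RintegralZl//; last by apply: integrable_sumr => j _; exact: integrable_sumr.
    apply: eq_Rintegral => t _; rewrite prod_fejer mulrCA; congr (_ * _).
    by rewrite mulr_sumr; apply: eq_bigr => j _; rewrite mulr_sumr.
  rewrite mulrCA; congr (_ * _); rewrite mulr_sumr; apply: eq_bigr => j _.
  rewrite mulr_sumr; apply: eq_bigr => l _.
  rewrite /J -(Rintegral_linear Bu (Ji j l)); congr (_ * _).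
  by apply: eq_Rintegral => t _; rewrite phE.
have Jjj j : J j j = \prod_i \int[mu]_x g i x.
  rewrite -(Rintegral_tuple_prod (mu := mu))//; apply: eq_Rintegral => x _.
  rewrite big1 ?cos0 ?mulr1// => i _.
  rewrite /th (_ : \col_k _ = 0) ?mulmx0 ?mxE ?mulr0 ?mul0r//.
  by apply/colP => k; rewrite !mxE subrr.
have Nd : N.+1%:R ^+ d != 0 :> R by rewrite expf_neq0// pnatr_eq0.
have cardN : \sum_(j : {ffun 'I_d -> 'I_N.+1}) (1 : R) = N.+1%:R ^+ d.
  by rewrite sumr_const card_ffun !card_ord natrX.
rewrite AE (_ : _ - _ = N.+1%:R ^- d * \sum_(j : {ffun 'I_d -> 'I_N.+1})
   \sum_(l : {ffun 'I_d -> 'I_N.+1} | l != j) J j l); last first.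
  set pg := \prod_i _.
  have -> : \sum_(j : {ffun 'I_d -> 'I_N.+1}) \sum_(l : {ffun 'I_d -> 'I_N.+1}) J j l =
      \sum_(j : {ffun 'I_d -> 'I_N.+1}) (1 * pg) +
      \sum_(j : {ffun 'I_d -> 'I_N.+1}) \sum_(l : {ffun 'I_d -> 'I_N.+1} | l != j) J j l.
    rewrite -big_split; apply: eq_bigr => j _.
    by rewrite (bigD1 j)//= Jjj mul1r.
  by rewrite -mulr_suml cardN mulrDr mulrA mulVf// mul1r addrAC subrr add0r.
rewrite normrM ger0_norm ?invr_ge0 ?exprn_ge0//.
rewrite ler_pdivrMl ?exprn_gt0// (le_trans (ler_norm_sum _ _ _))//.
rewrite -cardN mulr_suml; apply: ler_sum => j _; rewrite mul1r.
by rewrite (le_trans (ler_norm_sum _ _ _))//; exact: gD.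
Qed.
End lattice_sum_error.

(** * Convolution with a box *)

Section tensor_integrable.
Context {R : realType}.
Local Notation mu := (@lebesgue_measure R).
Variables (f g : R -> R).
Hypotheses (fi : mu.-integrable setT (EFin \o f)) (gi : mu.-integrable setT (EFin \o g)).

Let mf : measurable_fun setT f.
Proof. by apply/measurable_EFinP; exact: measurable_int fi. Qed.
Let mg : measurable_fun setT g.
Proof. by apply/measurable_EFinP; exact: measurable_int gi. Qed.

Local Open Scope ereal_scope.

(** The map (y, x) |-> (y, x - k y) preserves the product measure. The case k = 1
    is the integrand of a convolution, the case k = 0 that of a product. *)
Lemma integrable_tensor_shear (k : R) : (mu \x mu).-integrable setT
  (EFin \o (fun p : R * R => (f (p.2 - k * p.1) * g p.1)%R)).
Proof.
have mh : measurable_fun setT (fun p : R * R => (f (p.2 - k * p.1) * g p.1)%R).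
  apply: measurable_funM; last exact: measurableT_comp.
  apply: measurableT_comp => //; apply: measurable_funB => //.
  exact: measurable_funM.
have mEh : measurable_fun setT (EFin \o (fun p : R * R => (f (p.2 - k * p.1) * g p.1)%R)).
  exact/measurable_EFinP.
apply: (proj2 (@integrable12ltyP _ _ _ _ _ mu mu _ mEh)).
have E (y : R) : \int[mu]_x `|(EFin \o (fun p : R * R => (f (p.2 - k * p.1) * g p.1)%R)) (y, x)| =
    (\int[mu]_x `|(f x)%:E|) * `|(g y)%:E|.
  rewrite -[X in X * _](@ge0_integral_affine _ 1%R (- (k * y))%R)//; last first.
    by apply/measurable_EFinP; exact: measurableT_comp.
  rewrite normr1 mul1e -ge0_integralZr//; last first.
    apply/measurable_EFinP; apply: measurableT_comp => //; apply: measurableT_comp => //.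
    exact: measurable_affine.
  by apply: eq_integral => x _; rewrite /= normrM mul1r.
under eq_integral => y _ do rewrite E.
have /integrableP[_ fo] := fi; have /integrableP[_ go] := gi.
rewrite ge0_integralZl//.
- by rewrite lte_mul_pinfty ?ge0_fin_numE ?integral_ge0.
- by apply/measurable_EFinP; exact: measurableT_comp.
- exact: integral_ge0.
Qed.
End tensor_integrable.

Section Rfubini.
Context {R : realType}.
Local Notation mu := (@lebesgue_measure R).

Lemma RFubini (F : R * R -> R) : (mu \x mu)%E.-integrable setT (EFin \o F) ->
  (forall x, mu.-integrable setT (EFin \o (fun y => F (x, y)))) ->
  (forall y, mu.-integrable setT (EFin \o (fun x => F (x, y)))) ->
  mu.-integrable setT (EFin \o (fun x => \int[mu]_y F (x, y))) /\
  \int[mu]_x \int[mu]_y F (x, y) = \int[mu]_y \int[mu]_x F (x, y).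
Proof.
move=> Fi F1 F2.
have E1 x : (\int[mu]_y F (x, y))%:E = (\int[mu]_y (F (x, y))%:E)%E.
  by rewrite fineK//; exact: integrable_fin_num (F1 x).
have E2 y : (\int[mu]_x F (x, y))%:E = (\int[mu]_x (F (x, y))%:E)%E.
  by rewrite fineK//; exact: integrable_fin_num (F2 y).
split.
  by apply: eq_integrable (integrable_fubini_F Fi) => // x _; rewrite /= E1.
rewrite [LHS]/Rintegral [RHS]/Rintegral.
under eq_integral => x _ do rewrite E1.
under [in RHS]eq_integral => y _ do rewrite E2.
by rewrite (Fubini Fi).
Qed.
End Rfubini.

Section box_convolution.
Context {R : realType}.
Local Notation mu := (@lebesgue_measure R).
Variables (u : R) (u0 : 0 < u).
Local Notation I := (`[- (u / 2), u / 2[%classic : set R).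
Variables (f : R -> R) (mf : measurable_fun setT f) (H : R) (fH : forall x, `|f x| <= H).

Let iI : mu.-integrable setT (EFin \o (\1_I : R -> R)).
Proof. exact: integrable_indic_itv. Qed.

Lemma Rintegral_indic_box : \int[mu]_x (\1_I x : R) = u.
Proof.
rewrite (_ : Rintegral _ _ _ = \int[mu]_x (\1_I x * (1 : R))); last first.
  by apply: eq_Rintegral => x _; rewrite mulr1.
rewrite Rintegral_indic_mul Rintegral_cst//= lebesgue_measure_itv/= lte_fin.
have -> : - (u / 2) < u / 2 by rewrite -subr_gt0 opprK -splitr.
by rewrite /= mul1r opprK -splitr.
Qed.

Let H0 : 0 <= H. Proof. by apply: le_trans (fH 0). Qed.

Let mfx x : measurable_fun setT (fun y : R => f (x - y)).
Proof.
apply: measurableT_comp => //.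
by apply: measurable_funB => //; exact: measurable_id.
Qed.

Lemma integrable_convolution_box x :
  mu.-integrable setT (EFin \o (fun y => f (x - y) * hat1 u y)).
Proof.
have := integrable_mul_bounded iI (mfx x) (fun y => fH (x - y)).
by under eq_fun do rewrite mulrC.
Qed.

Lemma norm_convolution_box x : `|convolution f (hat1 u) x| <= u * H.
Proof.
rewrite /convolution (le_trans (le_normr_Rintegral _ _))//.
  exact: integrable_convolution_box.
rewrite -[u in leRHS]Rintegral_indic_box -RintegralZr//.
apply: le_Rintegral => //.
- exact: integrable_norm (integrable_convolution_box x).
- by apply: (integrable_mul_bounded (M := `|H|)).
- move=> y _; rewrite normrM mulrC [`|hat1 u y|]ger0_norm ?indicE//.
  by rewrite ler_wpM2l.
Qed.

Lemma convolution_box_refl x :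
  convolution f (hat1 u) x = \int[mu]_s (f s * \1_I (x - s)).
Proof.
rewrite /convolution -[LHS](@Rintegral_affine _ (-1) x); last 2 first.
- by rewrite oppr_eq0 oner_eq0.
- exact: integrable_convolution_box.
rewrite normrN1 mul1r; apply: eq_Rintegral => s _.
by rewrite (_ : -1 * s + x = x - s) ?subKr//; ring.
Qed.

(** Shifting the box changes its indicator only on two intervals of length
    |x - y|, one at each end. *)
Lemma convolution_box_lipschitz x y :
  `|convolution f (hat1 u) x - convolution f (hat1 u) y| <= 2 * H * `|x - y|.
Proof.
wlog xy : x y / x <= y.
  move=> W; have [/W//|/ltW/W] := leP x y.
  by rewrite distrC [`|y - x|]distrC.
have ir z : mu.-integrable setT (EFin \o (fun s => f s * \1_I (z - s))).
  have N1 : -1 != 0 :> R by rewrite oppr_eq0 oner_eq0.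
  apply: eq_integrable (integrable_affine z N1 (integrable_convolution_box z)) => //.
  by move=> s _ /=; rewrite (_ : -1 * s + z = z - s) ?subKr//; ring.
pose J : R -> R := fun s => \1_(`[x - u / 2, y - u / 2]) s + \1_(`[x + u / 2, y + u / 2]) s.
have Ji : mu.-integrable setT (EFin \o J).
  by apply: integrable_add; exact: integrable_indic_itv.
have J1 : \int[mu]_s J s = 2 * `|x - y|.
  have i1 (a b : R) : a <= b -> \int[mu]_s (\1_(`[a, b]) s : R) = b - a.
    move=> ab; rewrite (_ : Rintegral _ _ _ = \int[mu]_s (\1_(`[a, b]) s * (1 : R))); last first.
      by apply: eq_Rintegral => s _; rewrite mulr1.
    rewrite Rintegral_indic_mul Rintegral_cst//= lebesgue_measure_itv/= lte_fin.
    by case: ltP => /=; rewrite mul1r// => ba; apply/esym/eqP; rewrite subr_eq0 eq_le ab ba.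
  rewrite RintegralD//; [|exact: integrable_indic_itv|exact: integrable_indic_itv].
  by rewrite !i1 ?lerD2r// ler0_norm ?subr_le0//; ring.
rewrite !convolution_box_refl -RintegralB//.
rewrite (le_trans (le_normr_Rintegral _ _))//; first exact: integrable_sub.
rewrite [leRHS](_ : _ = H * (2 * `|x - y|)); last by ring.
rewrite -J1 -RintegralZl//; apply: le_Rintegral => //.
- exact: integrable_norm (integrable_sub (ir x) (ir y)).
- exact: integrable_scale.
move=> s _; rewrite -mulrBr normrM ler_pM//.
rewrite /J !indicE.
have mI a b (c d : bool) z : (z \in [set` Interval (BSide c a) (BSide d b)]) =
    (z \in Interval (BSide c a) (BSide d b)).
  by apply/idP/idP; rewrite inE.
rewrite !mI !in_itv/=.
case: (boolP (- (u / 2) <= x - s < u / 2)) => [/andP[a1 a2]|nA];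
case: (boolP (- (u / 2) <= y - s < u / 2)) => [/andP[b1 b2]|nB].
- by rewrite subrr normr0 addr_ge0.
- have sy : s <= y - u / 2.
    by apply: contraR nB; rewrite -ltNge => h; apply/andP; split; lra.
  rewrite subr0 normr1 (_ : x - u / 2 <= s <= y - u / 2) ?lerDl//.
  by apply/andP; split; lra.
- have sx : x + u / 2 <= s.
    by apply: contraR nA; rewrite -ltNge => h; apply/andP; split; lra.
  rewrite sub0r normrN1 (_ : x + u / 2 <= s <= y + u / 2) ?lerDr//.
  by apply/andP; split; lra.
- by rewrite subrr normr0 addr_ge0.
Qed.

Lemma measurable_convolution_box : measurable_fun setT (convolution f (hat1 u)).
Proof.
apply: continuous_measurable_fun; apply: (@lipschitz_continuous _ _ (2 * H)).
exact: convolution_box_lipschitz.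
Qed.

Lemma convolution_box_ge0 x : (forall y, 0 <= f y) -> 0 <= convolution f (hat1 u) x.
Proof. by move=> f0; apply: Rintegral_ge0 => y _; rewrite mulr_ge0// /hat1 indicE. Qed.

Lemma convolution_box_supp S x : (forall y, f y != 0 -> `|y| <= S) ->
  convolution f (hat1 u) x != 0 -> `|x| <= S + u.
Proof.
move=> fS; apply: contraNT; rewrite -ltNge => Sx; apply/eqP.
rewrite /convolution (_ : Rintegral _ _ _ = \int[mu]_x (0 : R)); last first.
  apply: eq_Rintegral => y _.
  have [->|fxy] := eqVneq (f (x - y)) 0; first by rewrite mul0r.
  rewrite /hat1 indicE; case: (boolP (y \in _)); rewrite ?mulr0// inE/= in_itv/= => /andP[y1 y2].
  have := fS _ fxy; have := ler_normD (x - y) y; rewrite subrK => h1 h2.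
  have : `|y| <= u / 2 by rewrite ler_norml; apply/andP; split; lra.
  by move=> h3; exfalso; move: Sx; rewrite ltNge => /negP; apply; lra.
by rewrite Rintegral_cst// mul0r.
Qed.

Section duality.
Hypothesis fi : mu.-integrable setT (EFin \o f).
Variables (psi : R -> R) (K : R).
Hypotheses (cpsi : continuous psi) (psiK : forall x, `|psi x| <= K).

Let mpsi : measurable_fun setT psi. Proof. exact: continuous_measurable_fun. Qed.

Lemma integrable_mul_shift b : mu.-integrable setT (EFin \o (fun x => f x * psi (x + b))).
Proof.
apply: (integrable_mul_bounded (M := K)) => //.
by apply: measurableT_comp => //; apply: measurable_funD.
Qed.

(** Convolution with the even box is symmetric for the pairing of functions, so
    it may be moved from f to the test function. *)
Lemma convolution_box_dual b :
  \int[mu]_x (convolution f (hat1 u) x * psi (x + b)) =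
  \int[mu]_y (\1_I y * \int[mu]_x (f x * psi (x + (b + y)))) /\
  mu.-integrable setT (EFin \o (fun y => \1_I y * \int[mu]_x (f x * psi (x + (b + y))))).
Proof.
pose F (p : R * R) : R := f (p.2 - 1 * p.1) * \1_I p.1 * psi (p.2 + b).
have Fi : (mu \x mu)%E.-integrable setT (EFin \o F).
  apply: (integrable_mul_bounded (M := K)) => //.
    exact: integrable_tensor_shear.
  by apply: measurableT_comp => //; apply: measurable_funD.
have F1 x : mu.-integrable setT (EFin \o (fun y => F (y, x))).
  apply: (@integrable_mul_bounded _ _ _ mu _ (fun=> psi (x + b)) `|psi (x + b)|) => //.
  by apply: eq_integrable (integrable_convolution_box x) => // y _; rewrite /= mul1r.
have F2E y : (fun x => F (y, x)) =
    (fun x => \1_I y * (f (1 * x - y) * psi (1 * x - y + (b + y)))).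
  apply/funext => x; rewrite /F /= !mul1r (_ : x - y + (b + y) = x + b); ring.
have F2 y : mu.-integrable setT (EFin \o (fun x => F (y, x))).
  rewrite F2E; apply: integrable_scale.
  exact: (integrable_affine (- y) (oner_neq0 R) (integrable_mul_shift (b + y))).
have F2I y : \int[mu]_x F (y, x) = \1_I y * \int[mu]_x (f x * psi (x + (b + y))).
  rewrite F2E RintegralZl//.
    rewrite -(Rintegral_affine (- y) (oner_neq0 R) (integrable_mul_shift (b + y))).
    by rewrite normr1 mul1r.
  exact: (integrable_affine (- y) (oner_neq0 R) (integrable_mul_shift (b + y))).
have [Gi FE] := RFubini Fi F2 F1; split.
  under [RHS]eq_Rintegral do rewrite -F2I.
  rewrite FE; apply: eq_Rintegral => x _.
  rewrite /convolution -RintegralZr//; last exact: integrable_convolution_box.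
  by apply: eq_Rintegral => y _; rewrite /F /= mul1r.
by apply: eq_integrable Gi => // y _; rewrite /= F2I.
Qed.

Lemma convolution_box_dual_le b C : (forall y, `|\int[mu]_x (f x * psi (x + y))| <= C) ->
  `|\int[mu]_x (convolution f (hat1 u) x * psi (x + b))| <= u * C.
Proof.
move=> EC; have [-> Ei] := convolution_box_dual b.
rewrite (le_trans (le_normr_Rintegral _ _))//.
rewrite -[u in leRHS]Rintegral_indic_box -RintegralZr//.
apply: le_Rintegral => //.
- exact: integrable_norm Ei.
- by apply: (integrable_mul_bounded (M := `|C|)).
- move=> y _; rewrite normrM [`|\1_I y|]ger0_norm ?indicE//.
  by rewrite ler_wpM2l.
Qed.

End duality.

(** Moved to the test function, the box averages a derivative, and thereby
    produces a difference of values of a primitive: this is the integration by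
    parts that gains a factor 1 / |om| in oscillatory integrals. *)
Lemma convolution_box_derive (psi dpsi : R -> R) (K K' b : R) :
  mu.-integrable setT (EFin \o f) ->
  continuous psi -> (forall x, `|psi x| <= K) ->
  continuous dpsi -> (forall x, `|dpsi x| <= K') ->
  (forall x : R, is_derive x 1 psi (dpsi x)) ->
  \int[mu]_x (convolution f (hat1 u) x * dpsi (x + b)) =
  \int[mu]_x (f x * psi (x + (b + u / 2))) - \int[mu]_x (f x * psi (x + (b - u / 2))).
Proof.
move=> fi cp pK cd dK dpsiE.
pose G (p : R * R) : R := f (p.2 - 0 * p.1) * \1_I p.1 * dpsi (p.2 + p.1 + b).
have md : measurable_fun setT dpsi by exact: continuous_measurable_fun.
have Gi : (mu \x mu)%E.-integrable setT (EFin \o G).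
  apply: (integrable_mul_bounded (M := K')) => //.
    exact: integrable_tensor_shear.
  by apply: measurableT_comp => //; apply: measurable_funD => //; exact: measurable_funD.
have fd y : mu.-integrable setT (EFin \o (fun x => f x * dpsi (x + y))).
  apply: (integrable_mul_bounded (M := K')) => //.
  by apply: measurableT_comp => //; apply: measurable_funD.
have G1E y : (fun x => G (y, x)) = (fun x => \1_I y * (f x * dpsi (x + (b + y)))).
  apply/funext => x; rewrite /G /= mul0r subr0 -addrA [y + b]addrC; ring.
have G1 y : mu.-integrable setT (EFin \o (fun x => G (y, x))).
  by rewrite G1E; exact: integrable_scale.
have G2E x : (fun y => G (y, x)) = (fun y => f x * (\1_I y * dpsi (x + b + y))).
  apply/funext => y; rewrite /G /= mul0r subr0 addrAC; ring.
have Id x : mu.-integrable setT (EFin \o (fun y => \1_I y * dpsi (x + b + y))).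
  apply: (integrable_mul_bounded (M := K')) => //.
  by apply: measurableT_comp => //; apply: measurable_funD.
have G2 x : mu.-integrable setT (EFin \o (fun y => G (y, x))).
  by rewrite G2E; exact: integrable_scale.
have [_ GF] := RFubini Gi G1 G2.
have [-> _] := convolution_box_dual fi cd dK b.
transitivity (\int[mu]_y \int[mu]_x G (y, x)).
  by apply: eq_Rintegral => y _; rewrite G1E RintegralZl.
rewrite GF -RintegralB; [|by []|exact: integrable_mul_shift cp pK _..].
apply: eq_Rintegral => x _; rewrite G2E RintegralZl// -mulrBr; congr (_ * _).
have cs c : continuous (fun y => dpsi (c + y)).
  move=> y; apply: (@continuous_comp _ _ _ (fun y => c + y) dpsi); last exact: cd.
  by apply: continuousD => //; exact: cst_continuous.
have ds c (y : R) : is_derive y 1 (fun y => psi (c + y)) (dpsi (c + y)).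
  have h : is_derive y (1 : R) (fun y => c + y) (1 : R).
    by have := is_deriveD (is_derive_cst c y (1 : R)) (is_derive_id y (1 : R)); rewrite add0r; apply.
  by have := is_derive1_comp (dpsiE (c + y)) h; rewrite mulr1.
have ic : mu.-integrable `[- (u / 2), u / 2] (EFin \o (fun y => dpsi (x + b + y))).
  apply: continuous_compact_integrable; first exact: segment_compact.
  exact/continuous_subspaceT/cs.
rewrite Rintegral_indic_mul Rintegral_itv_bndo_bndc; last first.
  by apply: integrableS ic => //; exact: subset_itv_co_cc.
have uu : - (u / 2) <= u / 2 by rewrite -subr_ge0 opprK -splitr ltW.
rewrite (Rintegral_FTC uu (cs (x + b)) (ds (x + b))).
by congr (psi _ - psi _); rewrite addrA.
Qed.
End box_convolution.

(** * Oscillatory integrals of hat functions *)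

Section hat_pairing.
Context {R : realType}.
Local Notation mu := (@lebesgue_measure R).
Variables (u : R) (u0 : 0 < u) (u1 : u <= 2^-1).

Lemma hatSS k : hat k.+2 u = convolution (hat k.+1 u) (hat1 u).
Proof. by []. Qed.

Lemma hat_props k : [/\ measurable_fun setT (hat k.+1 u),
  forall x, 0 <= hat k.+1 u x, forall x, `|hat k.+1 u x| <= 1 &
  forall x, hat k.+1 u x != 0 -> `|x| <= k.+1%:R].
Proof.
have [u0' u1'] : 0 < u /\ u <= 2^-1 by [].
elim: k => [|k [IHm IH0 IH1 IHs]].
  rewrite /hat /= /hat1; split => //.
  - by move=> x; rewrite indicE; case: (_ \in _); rewrite ?normr1 ?normr0.
  - move=> x; rewrite indicE; case: (boolP (_ \in _)); rewrite ?eqxx// inE/= in_itv/=.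
    by move=> /andP[a b] _; rewrite ler_norml; apply/andP; split; lra.
rewrite hatSS; split.
- exact: (measurable_convolution_box u IHm IH1).
- by move=> x; exact: convolution_box_ge0.
- move=> x; apply: le_trans (norm_convolution_box u0 IHm IH1 x) _; lra.
- move=> x h; apply: le_trans (convolution_box_supp IHs h) _.
  by rewrite -[in leRHS]natr1; lra.
Qed.

Lemma hat_lipschitz k x y : `|hat k.+2 u x - hat k.+2 u y| <= 2 * `|x - y|.
Proof.
have [IHm _ IH1 _] := hat_props k.
by have := convolution_box_lipschitz u IHm IH1 x y; rewrite mulr1.
Qed.

Lemma integrable_hat k : mu.-integrable setT (EFin \o hat k.+1 u).
Proof. have [hm _ h1 hs] := hat_props k; exact: integrable_bounded_supp hm h1 hs. Qed.

(** The integral of the hat of order k against psi shifted by b. The hat of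
    order 0 is the Dirac mass at the origin, which starts the induction on the
    order. *)
Definition hat_pairing k (psi : R -> R) (b : R) : R :=
  if k is k'.+1 then \int[mu]_x (hat k'.+1 u x * psi (x + b)) else psi b.

(** One box contributes its mass u. *)
Lemma hat_pairing_le k (psi : R -> R) (K C b : R) : continuous psi ->
  (forall x, `|psi x| <= K) -> (forall y, `|hat_pairing k psi y| <= C) ->
  `|hat_pairing k.+1 psi b| <= u * C.
Proof.
move=> cp pK; case: k => [|k] /= pC; last first.
  have [hm _ h1 _] := hat_props k.
  exact: (convolution_box_dual_le u0 hm h1 (integrable_hat k) cp pK).
have [hm _ h1 _] := hat_props 0.
rewrite (le_trans (le_normr_Rintegral _ _))//.
  apply: (integrable_mul_bounded (M := K) (integrable_hat 0)) => //.
  apply: measurableT_comp; first exact: continuous_measurable_fun.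
  exact: measurable_funD.
have i1 : mu.-integrable setT (EFin \o (\1_(`[- (u / 2), u / 2[%classic) : R -> R)).
  exact: integrable_indic_itv.
rewrite -[u in leRHS](Rintegral_indic_box u0) -RintegralZr//.
apply: le_Rintegral => //.
- apply: integrable_norm.
  apply: (integrable_mul_bounded (M := K) (integrable_hat 0)) => //.
  apply: measurableT_comp; first exact: continuous_measurable_fun.
  exact: measurable_funD.
- by apply: (integrable_mul_bounded (M := `|C|) i1).
- move=> y _; rewrite normrM /hat/= /hat1 ger0_norm ?indicE//.
  by rewrite ler_wpM2l.
Qed.

Lemma hat_pairing_derive k (psi dpsi : R -> R) (K K' b : R) :
  continuous psi -> (forall x, `|psi x| <= K) ->
  continuous dpsi -> (forall x, `|dpsi x| <= K') ->
  (forall x : R, is_derive x 1 psi (dpsi x)) ->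
  hat_pairing k.+1 dpsi b =
  hat_pairing k psi (b + u / 2) - hat_pairing k psi (b - u / 2).
Proof.
move=> cp pK cd dK dE; case: k => [|k] /=; last first.
  have [hm _ h1 _] := hat_props k.
  exact: (convolution_box_derive u0 hm h1 b (integrable_hat k) cp pK cd dK dE).
have cs : continuous (fun y => dpsi (y + b)).
  move=> y; apply: (@continuous_comp _ _ _ (fun y => y + b) dpsi); last exact: cd.
  by apply: continuousD => //; exact: cst_continuous.
have ds (y : R) : is_derive y 1 (fun y => psi (y + b)) (dpsi (y + b)).
  have h : is_derive y (1 : R) (fun y => y + b) (1 : R).
    by have := is_deriveD (is_derive_id y (1 : R)) (is_derive_cst b y (1 : R)); rewrite addr0; apply.
  by have := @is_derive1_comp R psi (fun y => y + b) y _ _ (dE (y + b)) h; rewrite mulr1.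
have ic : mu.-integrable `[- (u / 2), u / 2] (EFin \o (fun y => dpsi (y + b))).
  apply: continuous_compact_integrable; first exact: segment_compact.
  exact/continuous_subspaceT/cs.
rewrite /hat/= /hat1 Rintegral_indic_mul Rintegral_itv_bndo_bndc; last first.
  by apply: integrableS ic => //; exact: subset_itv_co_cc.
have uu : - (u / 2) <= u / 2 by rewrite -subr_ge0 opprK -splitr ltW.
rewrite (Rintegral_FTC uu cs ds).
by congr (psi _ - psi _); rewrite addrC.
Qed.

Lemma hat_pairing_lin k (psi1 psi2 : R -> R) (c K1 K2 b : R) :
  continuous psi1 -> (forall x, `|psi1 x| <= K1) ->
  continuous psi2 -> (forall x, `|psi2 x| <= K2) ->
  hat_pairing k (fun x => c * (psi1 x - psi2 x)) b =
  c * (hat_pairing k psi1 b - hat_pairing k psi2 b).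
Proof.
move=> c1 p1 c2 p2; case: k => [//|k]/=.
have ip (psi : R -> R) K : continuous psi -> (forall x, `|psi x| <= K) ->
    mu.-integrable setT (EFin \o (fun x => hat k.+1 u x * psi (x + b))).
  move=> cp pK; apply: (integrable_mul_bounded (M := K) (integrable_hat k)) => //.
  apply: measurableT_comp; first exact: continuous_measurable_fun.
  exact: measurable_funD.
rewrite -RintegralB//; [|exact: ip c1 p1|exact: ip c2 p2].
rewrite -RintegralZl//; last exact: integrable_sub (ip _ _ c1 p1) (ip _ _ c2 p2).
by apply: eq_Rintegral => x _; ring.
Qed.

(** Induction on k, peeling off one box at a time. If u <= kap, the mass of the
    box suffices. Otherwise one uses
    w cos (om x + ph) = om^-1 ((w sin (om x + ph))' - w' sin (om x + ph)):
    the box turns the derivative into two values of a pairing of lower order, and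
    the last term is again such a pairing, with w' in place of w. This makes three
    terms, hence the constant 3. The sequence ws lists the successive derivatives
    of w, and ph is arbitrary because sine and cosine alternate. *)
Lemma hat_oscillation k (ws : nat -> R -> R) (W om kap ph b : R) :
  0 <= W -> (u <= kap) \/ (om != 0 /\ `|om|^-1 <= kap) ->
  (forall i (x : R), is_derive x 1 (ws i) (ws i.+1 x)) ->
  (forall i x, (i <= k)%N -> `|ws i x| <= W) ->
  `|hat_pairing k (fun x => ws 0%N x * cos (om * x + ph)) b| <= W * (3 * kap) ^+ k.
Proof.
have u0' := u0; move=> W0 kapP; elim: k ws ph b => [|k IH] ws ph b dws wsW.
  rewrite expr0 mulr1 /= normrM -[leRHS]mulr1.
  by rewrite ler_pM// ?wsW// cos_max.
have cws i : continuous (ws i).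
  move=> x; apply: differentiable_continuous; apply/derivable1_diffP.
  by have [] := dws i x.
have ccos p : continuous (fun x => cos (om * x + p)).
  move=> x; apply: (@continuous_comp _ _ _ (fun x => om * x + p) (@cos R)).
    by apply: continuousD; [exact: mulrl_continuous|exact: cst_continuous].
  exact: continuous_cos.
have cc i p : continuous (fun x => ws i x * cos (om * x + p)).
  by move=> x; apply: continuousM; [exact: cws|exact: ccos].
have bc i p x : (i <= k.+1)%N -> `|ws i x * cos (om * x + p)| <= W.
  by move=> ik; rewrite normrM -[leRHS]mulr1 ler_pM// ?wsW// cos_max.
have IH0 p y : `|hat_pairing k (fun x => ws 0%N x * cos (om * x + p)) y| <= W * (3 * kap) ^+ k.
  by apply: IH => // i x ik; apply: wsW; exact: leqW.
have IH1 p y : `|hat_pairing k (fun x => ws 1%N x * cos (om * x + p)) y| <= W * (3 * kap) ^+ k.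
  by apply: (IH (fun i => ws i.+1)) => // i x ik; exact: wsW.
case: kapP => [ukap|[om0 omkap]].
  have kap0 : 0 <= kap by lra.
  rewrite (le_trans (hat_pairing_le b (cc 0%N ph) (fun x => bc 0%N ph x isT) (IH0 ph)))//.
  rewrite (le_trans (ler_wpM2r _ ukap))//.
    by rewrite mulr_ge0// exprn_ge0// mulr_ge0.
  rewrite exprS [leRHS](_ : _ = 3 * (kap * (W * (3 * kap) ^+ k))); last by ring.
  by rewrite ler_peMl ?ler1n// mulr_ge0// mulr_ge0// exprn_ge0// mulr_ge0.
have kap0 : 0 <= kap by apply: le_trans omkap; rewrite invr_ge0.
(* With this phase the sine is a cosine, to which the induction hypothesis
   applies. *)
pose p2 := ph - pi / 2.
have sinE x : sin (om * x + ph) = cos (om * x + p2) by rewrite /p2 addrA cosBpihalf.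
have dS (x : R) : is_derive x 1 (fun x => ws 0%N x * sin (om * x + ph))
    (ws 0%N x * (om * cos (om * x + ph)) + ws 1%N x * sin (om * x + ph)).
  have hl : is_derive x (1 : R) (fun x => om * x + ph) om.
    have := is_deriveD (is_deriveZ om (is_derive_id x (1 : R))) (is_derive_cst ph x (1 : R)).
    by rewrite addr0 /GRing.scale/= mulr1; apply.
  have hs := @is_derive1_comp R (@sin R) (fun x => om * x + ph) x _ _ (is_derive_sin (om * x + ph)) hl.
  have := is_deriveM (dws 0%N x) hs.
  rewrite /GRing.scale/= [sin _ * _]mulrC [cos _ * om]mulrC; apply.
pose D x := ws 0%N x * (om * cos (om * x + ph)) + ws 1%N x * cos (om * x + p2).
have cD : continuous D.
  move=> x; apply: cvgD; last exact: cc.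
  apply: cvgM; first exact: cws.
  by apply: cvgM; [exact: cvg_cst|exact: ccos].
have bD x : `|D x| <= `|om| * W + W.
  rewrite (le_trans (ler_normD _ _))// lerD ?bc// mulrCA normrM ler_wpM2l//.
  exact: bc.
have dS2 (x : R) : is_derive x 1 (fun x => ws 0%N x * cos (om * x + p2)) (D x).
  have := dS x; rewrite sinE; congr (is_derive _ _ _ _).
  by apply/funext => y; rewrite sinE.
have -> : (fun x => ws 0%N x * cos (om * x + ph)) =
    (fun x => om^-1 * (D x - ws 1%N x * cos (om * x + p2))).
  by apply/funext => x; rewrite /D; field.
rewrite (hat_pairing_lin _ _ _ cD bD (cc 1%N p2) (fun x => bc 1%N p2 x isT)).
rewrite (hat_pairing_derive k b (cc 0%N p2) (fun x => bc 0%N p2 x isT) cD bD dS2).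
set A1 := hat_pairing k _ (b + _); set A2 := hat_pairing k _ (b - _).
set A3 := hat_pairing k.+1 _ _.
have E1 : `|A1| <= W * (3 * kap) ^+ k by exact: IH0.
have E2 : `|A2| <= W * (3 * kap) ^+ k by exact: IH0.
have E0 : 0 <= W * (3 * kap) ^+ k by apply: le_trans E1.
have E3 : `|A3| <= W * (3 * kap) ^+ k.
  rewrite (le_trans (hat_pairing_le b (cc 1%N p2) (fun x => bc 1%N p2 x isT) (IH1 p2)))//.
  by rewrite ler_piMl//; have := u1; lra.
rewrite normrM normfV exprS [leRHS](_ : _ = kap * (3 * (W * (3 * kap) ^+ k))); last by ring.
rewrite ler_pM ?invr_ge0// (le_trans (ler_normB _ _))//.
have := ler_normB A1 A2; lra.
Qed.
End hat_pairing.

(** * Counting dyadic blocks *)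

Section dyadic_count.
Context {R : realType}.

Lemma sum_ffunS (V : nmodType) d M (F : {ffun 'I_d.+1 -> 'I_M} -> V) :
  \sum_s F s = \sum_(k < M) \sum_(s : {ffun 'I_d -> 'I_M})
    F [ffun i => oapp s k (unlift ord0 i)].
Proof.
rewrite pair_bigA /=.
pose h (p : 'I_M * {ffun 'I_d -> 'I_M}) : {ffun 'I_d.+1 -> 'I_M} :=
  [ffun i => oapp p.2 p.1 (unlift ord0 i)].
rewrite (reindex h)//=.
exists (fun g => (g ord0, [ffun j => g (lift ord0 j)])) => [[k s] _|g _] /=.
  rewrite /h ffunE unlift_none/=; congr pair.
  by apply/ffunP => j; rewrite !ffunE liftK.
apply/ffunP => i; rewrite !ffunE.
by case: unliftP => [j ->|->]/=; rewrite ?ffunE.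
Qed.

Definition weight d M (s : {ffun 'I_d -> 'I_M}) : nat := (\sum_i s i)%N.

Lemma weight_cons d M (k : 'I_M) (s : {ffun 'I_d -> 'I_M}) :
  weight [ffun i => oapp s k (unlift ord0 i)] = (k + weight s)%N.
Proof.
rewrite /weight big_ord_recl ffunE unlift_none /=; congr addn.
by apply: eq_bigr => j _; rewrite ffunE liftK.
Qed.

Lemma sum_half_pow_le (M n : nat) : \sum_(k < M | (n < k)%N) 2^-1 ^+ (k - n) <= 1 :> R.
Proof.
suff: \sum_(k < M | (n < k)%N) 2^-1 ^+ (k - n) <= 1 - 2^-1 ^+ (M - n.+1) :> R.
  by move=> /le_trans; apply; rewrite gerBl exprn_ge0// invr_ge0.
elim: M => [|M IH]; first by rewrite big_ord0 sub0n expr0 subrr.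
rewrite big_mkcond big_ord_recr/= -big_mkcond/=.
case: ltnP => nM; last first.
  rewrite addr0 (le_trans IH)// lerB//.
  have -> : (M.+1 - n.+1 = 0)%N by lia.
  by have -> : (M - n.+1 = 0)%N by lia.
have -> : (M - n = (M - n.+1).+1)%N by lia.
have -> : (M.+1 - n.+1 = (M - n.+1).+1)%N by lia.
by move: IH; rewrite exprS; lra.
Qed.

(** A vector s is counted with a weight that decays geometrically once |s|
    exceeds n, so that only the vectors with |s| close to n matter. Splitting off
    the first entry k, the values k <= n give the same sum in one dimension less
    with n - k in place of n, and the values k > n a geometric series. *)
Lemma sum_half_weight_le d M n :
  \sum_(s : {ffun 'I_d.+1 -> 'I_M} | (n <= weight s)%N) 2^-1 ^+ (weight s - n)
  <= 2 ^+ d.+1 * n.+1%:R ^+ d :> R.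
Proof.
pose G d n : R := \sum_(s : {ffun 'I_d -> 'I_M} | (n <= weight s)%N) 2^-1 ^+ (weight s - n).
have GS e m : G e.+1 m = \sum_(k < M | (k <= m)%N) G e (m - k)%N +
    \sum_(k < M | (m < k)%N) 2^-1 ^+ (k - m) * G e 0%N.
  rewrite /G big_mkcond sum_ffunS (bigID (fun k : 'I_M => (k <= m)%N))/=.
  congr (_ + _); last under eq_bigl do rewrite -ltnNge.
    apply: eq_bigr => k km; rewrite [RHS]big_mkcond; apply: eq_bigr => s _.
    by rewrite weight_cons leq_subLR subnBA// addnC.
  apply: eq_bigr => k km; rewrite mulr_sumr [RHS]big_mkcond; apply: eq_bigr => s _.
  rewrite weight_cons (leq_trans (ltnW km)) ?leq_addr//= subn0.
  have -> : (k + weight s - m = (k - m) + weight s)%N by lia.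
  exact: exprD.
have G0 m : G 0%N m = (m == 0)%:R.
  have w0 (s : {ffun 'I_0 -> 'I_M}) : weight s = 0%N by rewrite /weight big_ord0.
  rewrite /G; under eq_bigl do rewrite w0.
  under eq_bigr do rewrite w0 sub0n expr0.
  rewrite leqn0; case: eqP => _; last by rewrite big_pred0.
  by rewrite sumr_const card_ffun !card_ord expn0.
have step e m (b : R) : (forall k, (k <= m)%N -> G e k <= b) ->
    G e.+1 m <= m.+1%:R * b + G e 0%N.
  move=> Gb; rewrite GS lerD//; last first.
    rewrite -mulr_suml ler_piMl ?sum_half_pow_le//.
    by apply: sumr_ge0 => s _; rewrite exprn_ge0.
  have b0 : 0 <= b.
    by apply: le_trans (Gb 0%N isT); apply: sumr_ge0 => s _; rewrite exprn_ge0.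
  rewrite (le_trans (ler_sum _ (fun (k : 'I_M) _ => Gb (m - k)%N (leq_subr _ _))))//.
  rewrite sumr_const -[leLHS]mulr_natl ler_wpM2r// ler_nat.
  rewrite -[X in (_ <= X)%N]card_ord -sum1_card -sum1_card.
  rewrite (big_ord_widen_cond (maxn M m.+1) (fun k => (k <= m)%N) (fun=> 1%N)) ?leq_maxl//.
  rewrite [leqRHS](big_ord_widen_cond (maxn M m.+1) xpredT (fun=> 1%N)) ?leq_maxr//.
  rewrite [leqLHS]big_mkcond [leqRHS]big_mkcond leq_sum// => k _ /=.
  by rewrite ltnS; case: (k <= m)%N => //=; case: (k < M)%N.
rewrite -/(G d.+1 n); elim: d n => [|d IH] n.
  rewrite GS expr0 mulr1 expr1 -[2]/(1 + 1) lerD//.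
    under eq_bigr do rewrite G0 subn_eq0.
    rewrite (eq_bigr (fun k : 'I_M => (k == n :> nat)%:R)) => [|k kn]; last first.
      by rewrite eqn_leq kn.
    case: (ltnP n M) => nM; last first.
      by rewrite big1 // => k _; case: eqP => // kn; have := ltn_ord k; lia.
    rewrite (bigD1 (Ordinal nM))//= eqxx big1 ?addr0// => k /andP[_].
    by rewrite -val_eqE/= => /negbTE ->.
  by rewrite -mulr_suml G0 mulr1 sum_half_pow_le.
rewrite (le_trans (step _ _ (2 ^+ d.+1 * n.+1%:R ^+ d) _))//.
  move=> k kn; rewrite (le_trans (IH _))// ler_wpM2l ?exprn_ge0//.
  by rewrite lerXn2r ?nnegrE// ler_nat.
have h := IH 0%N; rewrite expr1n mulr1 in h.
rewrite (le_trans (lerD (lexx _) h))// [2 ^+ d.+2]exprS [n.+1%:R ^+ d.+1]exprS.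
have p0 : 0 <= 2 ^+ d.+1 :> R by rewrite exprn_ge0.
have n1 : 1 <= n.+1%:R * n.+1%:R ^+ d :> R by rewrite -exprS exprn_ege1// ler1n.
rewrite mulrCA [leRHS](_ : _ = 2 ^+ d.+1 * (n.+1%:R * n.+1%:R ^+ d) +
  2 ^+ d.+1 * (n.+1%:R * n.+1%:R ^+ d)); last by ring.
by rewrite lerD// ler_peMr.
Qed.
End dyadic_count.

(** * Sums over a Frolov lattice *)

Section frolov_sum.
Context {R : realType}.

Lemma dyadic_exists (y : R) : exists s : nat, y <= 2 ^+ s.
Proof.
exists (Num.truncn y).+1; rewrite ltW// (lt_trans (truncnS_gt y))//.
by rewrite -natrX ltr_nat ltn_expl.
Qed.

Definition dyadic_index (y : R) : nat := ex_minn (dyadic_exists y).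

Lemma dyadic_index_ge y : y <= 2 ^+ dyadic_index y.
Proof. by rewrite /dyadic_index; case: ex_minnP. Qed.

Lemma dyadic_index_min y n : y <= 2 ^+ n -> (dyadic_index y <= n)%N.
Proof. by rewrite /dyadic_index; case: ex_minnP => s _ h; exact: h. Qed.

Lemma dyadic_index_lt y : (0 < dyadic_index y)%N -> 2 ^+ (dyadic_index y).-1 < y.
Proof.
rewrite /dyadic_index; case: ex_minnP => s _ h s0; rewrite ltNge; apply/negP => /h.
by rewrite leqNgt prednK ?leqnn.
Qed.

(** The number of dyadic scales below T, which is the source of the logarithm in
    the final estimate. *)
Lemma dyadic_index_ln (T : R) : 1 <= T ->
  (dyadic_index T).+1%:R <= 2 / ln 2 * ln (2 * T).
Proof.
move=> T1; have T0 : 0 < T by apply: lt_le_trans T1.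
have l2 : 0 < ln 2 :> R by apply: ln_gt0; rewrite ltr1n.
rewrite lnM ?posrE// mulrAC ler_pdivlMr//.
have lT : 0 <= ln T by apply: ln_ge0.
case E : (dyadic_index T) => [|n]; first by rewrite mul1r; lra.
have := @dyadic_index_lt T; rewrite E /= => /(_ isT) nT.
have : n%:R * ln 2 <= ln T.
  rewrite mulr_natl -lnXn// ler_ln ?posrE// ?exprn_gt0//; exact: ltW.
rewrite -2!natr1; lra.
Qed.

Context {d : nat}.
Implicit Types (A : 'M[R]_d).

Lemma Lform_inj A : A \in unitmx -> injective (Lform A).
Proof.
move=> Au m1 m2 /(congr1 (mulmx (invmx A))); rewrite !mulKmx// => E.
by apply/colP => i; have := congr1 (fun X : 'cV[R]_d => X i 0) E; rewrite !mxE => /intr_inj.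
Qed.

(** The form in which the second Frolov property is used: for boxes centred at
    the origin and points indexed by a finite type. *)
Lemma frolov_card A (I : finType) (Q : pred I) (m : I -> 'cV[int]_d) (h : 'I_d -> R) :
  frolov A -> injective m -> (forall j, 0 < h j) ->
  (forall i, Q i -> forall j, `|Lform A (m i) j 0| <= h j) ->
  #|Q|%:R <= 2 ^+ d * \prod_j h j + 1 :> R.
Proof.
move=> [Au _ box_count] minj h0 Qh.
have [|n cn nle] := box_count (\col_j - h j) (\col_j h j).
  by move=> i; rewrite !mxE gt0_cp.
apply: (@le_trans _ _ n%:R).
  set S := _ `&` _ in cn; have fS : finite_set S by exists n.
  rewrite ler_nat -(card_fset_set cn) cardE -(size_map (fun i => Lform A (m i))).
  apply: uniq_leq_size.
    by rewrite map_inj_uniq ?enum_uniq// => i1 i2 /(Lform_inj Au)/minj.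
  move=> x /mapP[ i]; rewrite mem_enum => Qi ->.
  rewrite in_fset_set// inE; split; first by exists (m i).
  by move=> j; rewrite !mxE -ler_norml; have := Qh i Qi j; rewrite mxE.
rewrite (le_trans nle)// lerD2r -[X in 2 ^+ X]card_ord -prodr_const -big_split/=.
by rewrite ler_prod// => i _; rewrite !mxE; have := h0 i; lra.
Qed.

(** A dyadic version of the minimum of u and 1 / (a |x|): it bounds this minimum
    from above, and depends on x only through its dyadic scale. *)
Definition decay (a u x : R) : R := 2 * u / 2 ^+ dyadic_index (a * u * `|x|).

Lemma decay_ge0 (a u x : R) : 0 <= u -> 0 <= decay a u x.
Proof. by move=> u0; rewrite /decay divr_ge0 ?mulr_ge0// exprn_ge0. Qed.

Lemma decayP (a u x : R) : 0 < a -> 0 < u ->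
  u <= decay a u x \/ (x != 0 /\ (a * `|x|)^-1 <= decay a u x).
Proof.
move=> a0 u0; rewrite /decay.
case E : (dyadic_index _) => [|n]; first by left; rewrite expr0 divr1; lra.
right; have := @dyadic_index_lt (a * u * `|x|); rewrite E /= => /(_ isT) h.
have x0 : x != 0.
  by apply: contraTneq h => ->; rewrite normr0 mulr0 -leNgt exprn_ge0.
have nx : 0 < `|x| by rewrite normr_gt0.
split => //; rewrite ler_pdivlMr ?exprn_gt0// ler_pdivrMl ?mulr_gt0// exprS.
by have := ltW h; nra.
Qed.

(** A block of weight w holds about 2^w / T points, each contributing
    2^(- w (k + 2)). One factor 2^(-w) pays for the number of points; in the
    remaining power k + 1 >= 1 the excess of w over n leaves at least one factor
    2^(-(w - n)), which makes the sum over the blocks converge. *)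
Lemma dyadic_block_bound (T : R) (w n k : nat) :
  0 < T -> (n <= w)%N -> 2^-1 ^+ n <= T^-1 ->
  2 ^+ w / T * 2^-1 ^+ (w * k.+2) <= T ^- k.+2 * 2^-1 ^+ (w - n).
Proof.
move=> T0 nw TV.
have -> : (w * k.+2 = w + (n * k.+1 + (w - n) * k.+1))%N.
  by rewrite -mulnDl subnKC// mulnS.
rewrite exprD [2^-1 ^+ (_ + _)]exprD mulrAC -mulrA -mulrA mulrA.
rewrite -[X in X * _ <= _]exprMn mulfV// expr1n mul1r -exprVn exprSr.
rewrite [leRHS]mulrAC ler_wpM2r ?invr_ge0 ?(ltW T0)//.
rewrite ler_pM ?exprn_ge0//.
  by rewrite exprM lerXn2r ?nnegrE ?exprn_ge0 ?invr_ge0 ?(ltW T0).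
by apply: ler_wiXn2l => //; [lra|rewrite leq_pmulr].
Qed.

(** The points are sorted into blocks according to the dyadic scales
    S i j of the coordinates. By the first Frolov property no block of weight
    below n0, the dyadic scale of T, contains a point; by the second one
    each of the other blocks has few points; [sum_half_weight_le] then counts the
    blocks. *)
Lemma frolov_decay_sum A (r : nat) (a : R) (u : 'I_d -> R) (I : finType)
    (P : pred I) (m : I -> 'cV[int]_d) :
  (0 < d)%N -> (2 <= r)%N -> frolov A -> 0 < a -> (forall j, 0 < u j) ->
  1 <= a ^+ d * \prod_j u j -> injective m -> (forall i, P i -> m i != 0) ->
  \sum_(i | P i) \prod_j decay a (u j) (Lform A (m i) j 0) ^+ r <=
  ((2 ^+ d) ^+ r * (2 ^+ d + 1) * 2 ^+ d * (2 / ln 2) ^+ d.-1) *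
  a ^- (r * d) * ln (2 * (a ^+ d * \prod_j u j)) ^+ d.-1.
Proof.
move=> d0 r2 fA a0 u0; set v := \prod_j u j; set T := a ^+ d * v => T1 minj Pm.
have T0 : 0 < T by apply: lt_le_trans T1.
have v0 : 0 < v by exact: prodr_gt0.
pose S i j := dyadic_index (a * u j * `|Lform A (m i) j 0|).
pose wt i := (\sum_j S i j)%N.
have decE i : \prod_j decay a (u j) (Lform A (m i) j 0) ^+ r =
    (2 ^+ d * v) ^+ r * 2^-1 ^+ (wt i * r).
  rewrite prodrXl exprM -exprMn; congr (_ ^+ _).
  rewrite /decay; under eq_bigr do rewrite -exprVn.
  rewrite !big_split/= prodr_const card_ord; congr (_ * _).
  exact/esym/expr_sum.
have LwtE i h : (forall j, a * u j * `|Lform A (m i) j 0| <= h j) ->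
    T * `|\prod_j Lform A (m i) j 0| <= \prod_j h j.
  move=> Sh; rewrite /T /v -[X in a ^+ X]card_ord -prodr_const normr_prod -!big_split/=.
  by apply: ler_prod => j _; rewrite Sh !mulr_ge0// ltW.
have Twt i : P i -> T <= 2 ^+ wt i.
  move=> Pi; have [_ nrm _] := fA.
  rewrite -[T]mulr1 (le_trans (ler_wpM2l (ltW T0) (nrm _ (Pm _ Pi))))//.
  rewrite (le_trans (LwtE i (fun j => 2 ^+ S i j) _))//.
    by move=> j; exact: dyadic_index_ge.
  by rewrite /wt expr_sum.
pose n0 := dyadic_index T.
have n0wt i : P i -> (n0 <= wt i)%N by move=> /Twt; exact: dyadic_index_min.
(* A common bound for the scales, so that blocks form a finite type. *)
pose M := (\max_i \max_j S i j).+1.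
have SM i j : (S i j < M)%N.
  by rewrite ltnS (leq_trans (leq_bigmax j))// (leq_bigmax (F := fun i => \max_j S i j)%N i).
pose sig i : {ffun 'I_d -> 'I_M} := [ffun j => Ordinal (SM i j)].
have wtE i : weight (sig i) = wt i.
  by rewrite /weight /wt; apply: eq_bigr => j _; rewrite ffunE.
have cnt s : T <= 2 ^+ weight s ->
    #|[pred i | P i && (sig i == s)]|%:R <= (2 ^+ d + 1) * 2 ^+ weight s / T :> R.
  move=> Ts; pose h j : R := 2 ^+ s j / (a * u j).
  have h0 j : 0 < h j by rewrite divr_gt0 ?exprn_gt0// mulr_gt0.
  have := @frolov_card A I [pred i | P i && (sig i == s)] m h fA minj h0.
  move=> /(_ _)/le_trans; apply => [i /= /andP[_ /eqP si] j|].
    rewrite /h ler_pdivlMr ?mulr_gt0// mulrC.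
    by rewrite (le_trans (dyadic_index_ge _))// -si ffunE.
  have -> : \prod_j h j = 2 ^+ weight s / T.
    rewrite /h big_split/= prodfV big_split/= prodr_const card_ord; congr (_ / _).
    exact/esym/expr_sum.
  rewrite mulrA [in leRHS]mulrDl mul1r mulrDl lerD//.
  by rewrite ler_pdivlMr// mul1r.
have Tn0 : T <= 2 ^+ n0 by exact: dyadic_index_ge.
have TV : 2^-1 ^+ n0 <= T^-1 by rewrite exprVn lef_pV2 ?posrE ?exprn_gt0.
have blockle s : (n0 <= weight s)%N ->
    \sum_(i | P i && (sig i == s)) 2^-1 ^+ (wt i * r) <=
    (2 ^+ d + 1) * T ^- r * 2^-1 ^+ (weight s - n0) :> R.
  move=> ns; set w := weight s.
  have Tw : T <= 2 ^+ w by rewrite (le_trans Tn0)// ler_eXn2l// ltr1n.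
  rewrite (eq_bigr (fun=> 2^-1 ^+ (w * r))) => [|i /andP[_ /eqP si]]; last first.
    by rewrite -wtE si.
  rewrite sumr_const -[leLHS]mulr_natl.
  rewrite (le_trans (ler_wpM2r _ (cnt s Tw)))//.
  rewrite [leLHS](_ : _ = (2 ^+ d + 1) * (2 ^+ w / T * 2^-1 ^+ (w * r))); last first.
    by rewrite !mulrA.
  rewrite -[leRHS]mulrA ler_wpM2l ?addr_ge0 ?exprn_ge0//.
  have [r' rE] : exists r', r = r'.+2 by exists r.-2; lia.
  by rewrite rE; exact: dyadic_block_bound.
under eq_bigr do rewrite decE.
rewrite -mulr_sumr (partition_big sig (fun s => (n0 <= weight s)%N)) => [|i Pi]; last first.
  by rewrite wtE n0wt.
have sumle : \sum_(s : {ffun 'I_d -> 'I_M} | (n0 <= weight s)%N)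
    \sum_(i | P i && (sig i == s)) 2^-1 ^+ (wt i * r) <=
    (2 ^+ d + 1) * T ^- r * (2 ^+ d * (2 / ln 2 * ln (2 * T)) ^+ d.-1) :> R.
  rewrite (le_trans (ler_sum _ (fun s ns => blockle s ns)))// -mulr_sumr.
  rewrite ler_wpM2l ?mulr_ge0 ?invr_ge0 ?addr_ge0 ?exprn_ge0 ?(ltW T0)//.
  have [d' dE] : exists d', d = d'.+1 by exists d.-1; lia.
  move: (M); rewrite dE => M'.
  rewrite (le_trans (sum_half_weight_le d' M' n0))// ler_wpM2l ?exprn_ge0//.
  rewrite lerXn2r ?nnegrE ?dyadic_index_ln//.
  by apply: le_trans (dyadic_index_ln T1).
apply: (le_trans (ler_wpM2l _ sumle)); first by rewrite exprn_ge0 ?mulr_ge0 ?exprn_ge0 ?(ltW v0).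
rewrite le_eqVlt; apply/orP; left; apply/eqP.
have ar : a ^+ (r * d) != 0 by rewrite expf_neq0// lt0r_neq0.
have vr : v ^+ r != 0 by rewrite expf_neq0// lt0r_neq0.
have TrE : T ^- r = a ^- (r * d) * v ^- r.
  by rewrite /T exprMn -exprM [(d * r)%N]mulnC invfM.
have E1 : (2 ^+ d * v) ^+ r = (2 ^+ d) ^+ r * v ^+ r by exact: exprMn.
have E2 : (2 / ln 2 * ln (2 * T)) ^+ d.-1 = (2 / ln 2) ^+ d.-1 * ln (2 * T) ^+ d.-1.
  exact: exprMn.
rewrite {}TrE {}E1 {}E2.
rewrite [LHS](_ : _ = (v ^+ r * v ^- r) * ((2 ^+ d) ^+ r * (2 ^+ d + 1) * 2 ^+ d *
  (2 / ln 2) ^+ d.-1 * a ^- (r * d) * ln (2 * T) ^+ d.-1)); first by rewrite mulfV ?mul1r.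
move: (2 ^+ d : R) ((2 / ln 2) ^+ d.-1) (ln (2 * T) ^+ d.-1) (a ^- (r * d)) => p q l b.
by move: (p ^+ r) (v ^+ r) (v ^- r) => p' x y; ring.
Qed.
End frolov_sum.

(** * The window function *)

Section window.
Context {R : realType}.
Variable w : R -> R.
Hypothesis smooth : infinitely_differentiable w.
Hypothesis suppw : supp w `<=` `](- 2^-1), (3 / 2)[.

Lemma window_is_derive i (x : R) : is_derive x 1 (w^`(i)%classic) (w^`(i.+1)%classic x).
Proof.
rewrite derive1nS derive1E; apply/derivableP; exact: smooth.
Qed.

Lemma window_continuous i : continuous (w^`(i)%classic).
Proof.
move=> x; apply: differentiable_continuous; apply/derivable1_diffP.
exact: smooth.
Qed.

(** The complement of the support is open, so that w vanishes near each of its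
    points. *)
Lemma derivative_vanishes i x : ~ supp w x -> w^`(i)%classic x = 0.
Proof.
have ow : open (~` supp w) by apply: closed_openC; exact: closed_closure.
elim: i x => [|i IH] x nx.
  rewrite derive1n0; apply: contrapT => /eqP wx; apply: nx.
  exact: subset_closure.
rewrite derive1nS derive1E.
have -> : 'D_1 (w^`(i)%classic) x = 'D_1 (cst 0 : R -> R) x.
  apply: near_eq_derive; apply: filterS (open_nbhs_nbhs (conj ow nx)) => y ny.
  exact: IH.
exact: derive_cst.
Qed.

Lemma derivative_support i x : ~~ (- 2^-1 < x < 3 / 2) -> w^`(i)%classic x = 0.
Proof.
move=> nx; apply: derivative_vanishes => /suppw.
by rewrite /= in_itv/=; apply/negP.
Qed.

Lemma derivative_bounded i : exists W, forall x, `|w^`(i)%classic x| <= W.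
Proof.
have ab : - 2^-1 <= 3 / 2 :> R by lra.
have cw : {within `[- 2^-1, 3 / 2], continuous (fun x => `|w^`(i)%classic x|)}.
  apply: continuous_subspaceT => x.
  apply: continuous_comp; [exact: window_continuous|exact: norm_continuous].
have [c _ cmax] := EVT_max ab cw.
exists `|w^`(i)%classic c| => x.
case: (boolP (- 2^-1 < x < 3 / 2)) => [/andP[x1 x2]|nx].
  by apply: cmax; rewrite in_itv/= !ltW.
by rewrite derivative_support// normr0.
Qed.

Lemma derivatives_bounded r : exists2 W, 0 <= W &
  forall i x, (i <= r)%N -> `|w^`(i)%classic x| <= W.
Proof.
elim: r => [|r [W W0 IH]].
  have [W WP] := derivative_bounded 0; exists W; first by apply: le_trans (WP 0).
  by move=> i x; rewrite leqn0 => /eqP ->.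
have [W' WP] := derivative_bounded r.+1.
exists (Num.max W W'); first by rewrite le_max W0.
move=> i x; rewrite leq_eqVlt => /orP[/eqP ->|]; first by rewrite le_max WP orbT.
by rewrite ltnS => ir; rewrite le_max IH.
Qed.

Lemma window_lipschitz W : (forall x, `|w^`(1)%classic x| <= W) ->
  forall x y, `|w x - w y| <= W * `|x - y|.
Proof.
move=> WP x y; wlog xy : x y / x <= y.
  move=> H; have [/H//|/ltW/H] := leP x y.
  by rewrite distrC [`|y - x|]distrC.
have [||c _ E] := @MVT_segment _ w (w^`(1)%classic) x y xy.
- by move=> t _; have := window_is_derive 0 t.
- exact: continuous_subspaceT (@window_continuous 0).
by rewrite distrC E normrM [`|x - y|]distrC ler_wpM2r.
Qed.

Hypothesis partition1 : forall t : R, \sum_(k \in [set: int]) w (t + k%:~R) = 1.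

(** Only the translates by -1, 0 and 1 of the window meet the unit interval. *)
Lemma window_partition t : 0 <= t < 1 -> w (t - 1) + w t + w (t + 1) = 1.
Proof.
move=> /andP[t0 t1]; rewrite -[RHS](partition1 t).
have w0 x : ~~ (- 2^-1 < x < 3 / 2) -> w x = 0 by exact: (@derivative_support 0).
have -> : \sum_(k \in [set: int]) w (t + k%:~R) =
    \sum_(k \in [set` [:: -1; 0; 1 : int]]) w (t + k%:~R).
  apply/esym/fsbig_widen => // k [_ /= nk]; apply: w0.
  apply: contra_notN nk => /andP[k1 k2].
  have : (-2 < k)%R by rewrite -(ltr_int R); lra.
  have : (k < 2)%R by rewrite -(ltr_int R); lra.
  rewrite !inE; lia.
rewrite -fsbig_seq// !big_cons big_nil.
by rewrite /= !addr0 mulrN1z mulr1z addrA.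
Qed.
End window.

(** * The periodized hat *)

Section periodized_hat.
Context {R : realType}.
Local Notation mu := (@lebesgue_measure R).
Variables (u z : R) (u0 : 0 < u) (u1 : u <= 2^-1) (z01 : 0 <= z < 1) (k : nat).
Local Notation r := k.+2.
Local Notation K := r.+1.

(** On [0, 1) this finite sum is the full periodization of the hat centred at z:
    for 0 <= z < 1 and u <= 1/2 the omitted translates do not reach [0, 1). *)
Definition perhat (x : R) : R :=
  \sum_(l < K.*2.+1) hat r u ((l%:Z - K%:Z)%:~R + x - z).

Let hat_supp (x : R) : r%:R < `|x| -> hat r u x = 0.
Proof.
have [_ _ _ hs] := hat_props u0 u1 k.+1.
by move=> rx; apply: contrapT => /eqP /hs; rewrite leNgt rx.
Qed.

Lemma perhat_bound x : `|perhat x| <= K.*2.+1%:R.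
Proof.
have [_ _ h1 _] := hat_props u0 u1 k.+1.
rewrite (le_trans (ler_norm_sum _ _ _))// (le_trans (ler_sum _ (fun l _ => h1 _)))//.
by rewrite sumr_const card_ord.
Qed.

Lemma perhat_lipschitz x y : `|perhat x - perhat y| <= K.*2.+1%:R * (2 * `|x - y|).
Proof.
rewrite /perhat -sumrB (le_trans (ler_norm_sum _ _ _))//.
rewrite (le_trans (ler_sum _ (fun l _ => hat_lipschitz u0 u1 _ _ _)))//.
rewrite (eq_bigr (fun=> 2 * `|x - y|)) => [|l _].
  by rewrite sumr_const card_ord -[leLHS]mulr_natl.
by congr (_ * `|_|); ring.
Qed.

(** Periodicity can only hold in the range where the truncation of the sum does
    not show: the shift exchanges the first term for one past the last, and both
    of these vanish. *)
Lemma perhat_shift x : -1 <= x < 1 -> perhat (x + 1) = perhat x.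
Proof.
move=> /andP[x1 x2]; have /andP[z0 z1] := z01.
have K1 : (K%:R : R) = r%:R + 1 by rewrite -[K]addn1 natrD.
have r0 : 0 <= (r%:R : R) by exact: ler0n.
have tel n (h : nat -> R) : h 0%N = 0 -> h n.+1 = 0 ->
    \sum_(l < n.+1) h l.+1 = \sum_(l < n.+1) h l.
  move=> h0 hn; rewrite [LHS]big_ord_recr/= hn addr0 [RHS]big_ord_recl/= h0 add0r.
  by apply: eq_bigr => l _.
pose h l : R := hat r u ((l%:Z - K%:Z)%:~R + x - z).
transitivity (\sum_(l < K.*2.+1) h l.+1).
  apply: eq_bigr => l _; congr (hat _ _ _).
  have -> : l.+1%:Z - K%:Z = (l%:Z - K%:Z) + 1 by lia.
  by rewrite [in RHS]intrD mulr1z; ring.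
apply: (tel K.*2 h); apply: hat_supp.
  rewrite sub0r mulrNz -pmulrn K1 ltr0_norm; lra.
have -> : (K.*2.+1%:Z - K%:Z)%:~R = K%:R + 1 :> R.
  have -> : K.*2.+1%:Z - K%:Z = K.+1%:Z by lia.
  exact/esym/natr1.
rewrite K1 gtr0_norm; lra.
Qed.

Lemma perhat_frac x : - 2^-1 <= x < 3 / 2 ->
  perhat (x - (Num.floor x)%:~R) = perhat x.
Proof.
move=> /andP[x1 x2].
have [x0|x0] := ltP x 0.
  rewrite (@floor_def _ x (-1)); last by rewrite mulrN1z; lra.
  by rewrite mulrN1z opprK perhat_shift//; lra.
have [x1'|x1'] := ltP x 1.
  by rewrite (@floor_def _ x 0) ?subr0//; lra.
rewrite (@floor_def _ x 1); last by lra.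
rewrite mulr1z -[in RHS](subrK 1 x) perhat_shift//; lra.
Qed.

Lemma hat_far (x : R) (m : int) : 0 <= x < 1 -> hat r u (m%:~R + x - z) != 0 ->
  `|m| <= K%:Z.
Proof.
move=> /andP[x0 x1]; have /andP[z0 z1] := z01.
apply: contraR; rewrite -ltNge => Km; apply/eqP/hat_supp.
have : (K%:Z + 1 <= `|m|)%R by lia.
rewrite -(ler_int R) intrD intr_norm -pmulrn -[K]addn1 natrD => h.
have h2 := lerB_normD m%:~R (x - z).
have : `|x - z| < 1 by rewrite ltr_norml; apply/andP; split; lra.
rewrite -addrA; move: h h2; lra.
Qed.
End periodized_hat.

(** * One coordinate of the windowed hat *)

Section factor.
Context {R : realType}.
Local Notation mu := (@lebesgue_measure R).
Variable w : R -> R.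
Hypothesis smooth : infinitely_differentiable w.
Hypothesis suppw : supp w `<=` `](- 2^-1), (3 / 2)[.
Hypothesis partition1 : forall t : R, \sum_(k \in [set: int]) w (t + k%:~R) = 1.
Variables (k : nat) (W : R).
Local Notation r := k.+2.
Local Notation K := r.+1.
Hypothesis W0 : 0 <= W.
Hypothesis WP : forall i x, (i <= r)%N -> `|w^`(i)%classic x| <= W.
Variables (u z : R) (u0 : 0 < u) (u1 : u <= 2^-1) (z01 : 0 <= z < 1).

(** One coordinate of the function that is summed over the lattice: the window
    carries the periodic hat over to a function with bounded support. *)
Definition factor (x : R) : R := w x * perhat u z k x.

Let Wb x : `|w x| <= W.
Proof. exact: (WP x (isT : (0 <= r)%N)). Qed.

Lemma factor_bound x : `|factor x| <= W * K.*2.+1%:R.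
Proof. by rewrite normrM ler_pM// perhat_bound. Qed.

Lemma factor_lipschitz x y :
  `|factor x - factor y| <= 3 * W * K.*2.+1%:R * `|x - y|.
Proof.
rewrite /factor.
have -> : w x * perhat u z k x - w y * perhat u z k y =
    w x * (perhat u z k x - perhat u z k y) + (w x - w y) * perhat u z k y by ring.
rewrite (le_trans (ler_normD _ _))// !normrM.
have W1 : `|w x - w y| <= W * `|x - y|.
  by apply: window_lipschitz => // t; exact: WP.
rewrite (le_trans (lerD (ler_pM _ _ (Wb x) (perhat_lipschitz z u0 u1 k x y))
  (ler_pM _ _ W1 (perhat_bound z u0 u1 k y))))//.
rewrite le_eqVlt; apply/orP; left; apply/eqP; move: (K.*2.+1%:R : R) => q; ring.
Qed.

Lemma factor_supp x : factor x != 0 -> - 2^-1 < x < 3 / 2.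
Proof.
apply: contraR => nx; rewrite /factor.
by have := derivative_support suppw 0 nx; rewrite derive1n0 => ->; rewrite mul0r.
Qed.

Lemma factor_oscillation (om kap ph : R) : 
  (u <= kap) \/ (om != 0 /\ `|om|^-1 <= kap) ->
  `|\int[mu]_x (factor x * cos (om * x + ph))| <= K.*2.+1%:R * (W * (3 * kap) ^+ r).
Proof.
move=> kapP.
have ccos : continuous (fun x => cos (om * x + ph)).
  move=> x; apply: (@continuous_comp _ _ _ (fun x => om * x + ph) (@cos R)).
    by apply: continuousD; [exact: mulrl_continuous|exact: cst_continuous].
  exact: continuous_cos.
pose psi x := w x * cos (om * x + ph).
have psiW x : `|psi x| <= W by rewrite normrM -[leRHS]mulr1 ler_pM// cos_max.
have mpsi : measurable_fun setT psi.
  apply: measurable_funM; apply: continuous_measurable_fun => //.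
  by move=> x; have := @window_continuous _ w smooth 0 x; rewrite derive1n0.
have ih (b : R) : mu.-integrable setT (EFin \o (fun x => hat r u (b + x - z) * psi x)).
  apply: (integrable_mul_bounded (M := W)) => //.
  apply: eq_integrable (integrable_affine (b - z) (oner_neq0 R) (integrable_hat u0 u1 k.+1)) => //.
  by move=> x _ /=; rewrite mul1r addrCA addrA.
have ihE (b : R) : \int[mu]_x (hat r u (b + x - z) * psi x) = hat_pairing u r psi (z - b).
  rewrite /hat_pairing -[LHS](@Rintegral_affine _ 1 (z - b)) ?oner_neq0// normr1 mul1r.
  apply: eq_Rintegral => x _; rewrite mul1r; congr (hat _ _ _ * _); ring.
rewrite (_ : Rintegral _ _ _ = \sum_(l < K.*2.+1) hat_pairing u r psi (z - (l%:Z - K%:Z)%:~R)).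
  have pb b : `|hat_pairing u r psi b| <= W * (3 * kap) ^+ r.
    rewrite (_ : psi = fun x => w^`(0)%classic x * cos (om * x + ph))//.
    apply: (hat_oscillation u0 u1 (ws := fun i => w^`(i)%classic)) => //.
    by move=> i x; exact: window_is_derive.
  rewrite (le_trans (ler_norm_sum _ _ _))// (le_trans (ler_sum _ (fun l _ => pb _)))//.
  by rewrite sumr_const card_ord -[leLHS]mulr_natl.
under [RHS]eq_bigr do rewrite -ihE.
rewrite -Rintegral_sumr//; apply: eq_Rintegral => x _.
by rewrite /factor /perhat mulrAC mulrC mulr_suml.
Qed.

Lemma factor_integrable : mu.-integrable setT (EFin \o factor).
Proof.
have cf := lipschitz_continuous factor_lipschitz.
apply: (integrable_bounded_supp (S := 2)).
- exact: continuous_measurable_fun.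
- exact: factor_bound.
- by move=> x /factor_supp/andP[a b]; rewrite ler_norml; apply/andP; split; lra.
Qed.

Lemma integrable_unit_perhat : mu.-integrable setT
  (EFin \o (fun x => \1_(`[0, 1[%classic : set R) x * perhat u z k x)).
Proof.
have cp : continuous (perhat u z k).
  apply: (@lipschitz_continuous _ _ (K.*2.+1%:R * 2)) => x y.
  by rewrite -mulrA; exact: perhat_lipschitz.
apply: (@integrable_mul_bounded _ _ _ mu (\1_(`[0, 1[%classic)) (perhat u z k) K.*2.+1%:R).
- exact: integrable_indic_itv.
- exact: continuous_measurable_fun.
- exact: perhat_bound.
Qed.

(** Unfolding: the three unit intervals that meet the support of w are shifted to
    [0, 1), where the translates of w add up to 1. *)
Lemma factor_mean :
  \int[mu]_x factor x = \int[mu]_x (\1_(`[0, 1[%classic : set R) x * perhat u z k x).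
Proof.
pose I (x : R) : R := \1_(`[0, 1[%classic : set R) x.
have IE (x : R) : I x = ((0 <= x) && (x < 1))%:R :> R.
  rewrite /I indicE (_ : (x \in _) = (0 <= x) && (x < 1))//.
  by apply/idP/idP; rewrite inE/= in_itv.
have fI (c : R) : mu.-integrable setT (EFin \o (fun x => I x * factor (x + c))).
  have cf := lipschitz_continuous factor_lipschitz.
  apply: (@integrable_mul_bounded _ _ _ mu I (fun x => factor (x + c)) (W * K.*2.+1%:R)).
  - exact: integrable_indic_itv.
  - apply: measurableT_comp; first exact: continuous_measurable_fun.
    exact: measurable_funD.
  - by move=> x; exact: factor_bound.
have fI2 (c : R) : mu.-integrable setT (EFin \o (fun x => I (x - c) * factor x)).
  apply: eq_integrable (integrable_affine (- c) (oner_neq0 R) (fI c)) => // x _ /=.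
  by rewrite mul1r subrK.
have tr (c : R) : \int[mu]_x (I (x - c) * factor x) = \int[mu]_x (I x * factor (x + c)).
  rewrite -[RHS](Rintegral_affine (- c) (oner_neq0 R) (fI c)) normr1 mul1r.
  by apply: eq_Rintegral => x _; rewrite mul1r subrK.
have I1 y : 0 <= y -> y < 1 -> I y = 1 by move=> y0 y1; rewrite IE y0 y1.
have I0 y : y < 0 \/ 1 <= y -> I y = 0.
  by rewrite IE; case=> [y0|y1]; [rewrite leNgt y0|rewrite [y < 1]ltNge y1 andbF].
have split3 x : factor x = (I (x - (-1)) * factor x + I (x - 0) * factor x) + I (x - 1) * factor x.
  have [->|/factor_supp/andP[x1 x2]] := eqVneq (factor x) 0; first by rewrite !mulr0 !addr0.
  rewrite -!mulrDl.
  have [h1|h1] := ltP x 0; [|have [h2|h2] := ltP x 1].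
  - by rewrite I1 ?(I0 (x - 0)) ?(I0 (x - 1)) ?addr0 ?mul1r//; [left|left| |]; lra.
  - by rewrite I0 ?(I1 (x - 0)) ?(I0 (x - 1)) ?add0r ?addr0 ?mul1r//; [left| | |right]; lra.
  - by rewrite I0 ?(I0 (x - 0)) ?(I1 (x - 1)) ?add0r ?mul1r//; [| |right|right]; lra.
transitivity (\int[mu]_x ((I (x - (-1)) * factor x + I (x - 0) * factor x) + I (x - 1) * factor x)).
  by apply: eq_Rintegral => x _; exact: split3.
rewrite RintegralD//; last exact: integrable_add.
rewrite RintegralD// !tr -RintegralD// -RintegralD//; last exact: integrable_add.
apply: eq_Rintegral => x _; rewrite -/(I x) -!mulrDr IE.
case: (boolP (0 <= x < 1)) => [x01|]; last by rewrite !mul0r.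
have /andP[x0 x1] := x01; rewrite !mul1r /factor addr0.
rewrite perhat_shift//; last by apply/andP; split; lra.
have -> : perhat u z k (x + -1) = perhat u z k x.
  by rewrite -[in RHS](subrK 1 x) perhat_shift//; apply/andP; split; lra.
by rewrite -!mulrDl (window_partition suppw partition1 x01) mul1r.
Qed.
End factor.

(** * The error bound for the windowed hat *)

Section tensor.
Context {R : realType}.
Local Notation mu := (@lebesgue_measure R).
Variable w : R -> R.
Hypothesis smooth : infinitely_differentiable w.
Hypothesis suppw : supp w `<=` `](- 2^-1), (3 / 2)[.
Variables (k : nat) (W : R).
Local Notation r := k.+2.
Local Notation K := r.+1.
Hypothesis W0 : 0 <= W.
Hypothesis WP : forall i x, (i <= r)%N -> `|w^`(i)%classic x| <= W.
Variables (d : nat) (u z : 'I_d -> R).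
Hypotheses (u0 : forall i, 0 < u i) (u1 : forall i, u i <= 2^-1).

(** The number of translated hats times the bound of [hat_oscillation]; the
    factor 2 accounts for adding the sine and cosine parts of a transform. *)
Definition oscillation_const : R := 2 * (K.*2.+1%:R * (W * 3 ^+ r)).
Local Notation Q := oscillation_const.

(** The squared modulus of the transform factorizes by [tuple_trig_prod], and
    dominates the square of its real part. *)
Lemma tensor_oscillation (th kap : 'I_d -> R) :
  (forall i, 0 <= kap i) ->
  (forall i, u i <= kap i \/ (th i != 0 /\ `|th i|^-1 <= kap i)) ->
  `|\int[tuple_measure mu d]_t (\prod_i factor w k (u i) (z i) (tnth t i) *
      cos (\sum_i th i * tnth t i))| <= Q ^+ d * \prod_i kap i ^+ r.
Proof.
move=> kap0 kapP.
have [_ _ E] := tuple_trig_prod th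
  (fun i => factor_integrable smooth suppw WP (z i) (u0 i) (u1 i)).
set X := \int[_]_t _ in E *; set Y := \int[_]_t _ in E.
pose q : R := K.*2.+1%:R * (W * 3 ^+ r).
have q0 : 0 <= q by rewrite mulr_ge0// mulr_ge0// exprn_ge0.
have osc i ph : `|\int[mu]_x (factor w k (u i) (z i) x * cos (th i * x + ph))| <=
    q * kap i ^+ r.
  have := factor_oscillation smooth W0 WP (z i) (u0 i) (u1 i) ph (kapP i).
  by rewrite /q exprMn !mulrA.
have -> : Q ^+ d * \prod_i kap i ^+ r = \prod_i (2 * (q * kap i ^+ r)).
  rewrite [RHS](eq_bigr (fun i => Q * kap i ^+ r)) => [|i _]; last exact: mulrA.
  by rewrite [RHS]big_split/= prodr_const card_ord.
have b0 i : 0 <= 2 * (q * kap i ^+ r) by rewrite mulr_ge0// mulr_ge0// exprn_ge0.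
rewrite -[leRHS]ger0_norm ?prodr_ge0// -ler_sqr ?nnegrE// !real_normK ?num_real//.
apply: (le_trans (_ : _ <= X ^+ 2 + Y ^+ 2)); first by rewrite lerDl sqr_ge0.
rewrite E -prodrXl; apply: ler_prod => i _; rewrite addr_ge0 ?sqr_ge0//=.
(* A sine is a cosine with the phase - pi / 2. *)
have s1 : `|\int[mu]_x (factor w k (u i) (z i) x * sin (th i * x))| <= q * kap i ^+ r.
  by have := osc i (- (pi / 2)); under eq_Rintegral do rewrite cosBpihalf.
have := osc i 0; under eq_Rintegral do rewrite addr0.
move: s1; set a := Rintegral _ _ _; set b := Rintegral _ _ _.
move: (q * _) => c; rewrite !ler_norml => /andP[a1 a2] /andP[b1 b2]; nra.
Qed.

(** The nodes lie on the lattice generated by B; its dual is generated by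
    a *: A. *)
Lemma dual_lattice (A : 'M[R]_d) (a : R) : A \in unitmx -> a != 0 ->
  let B := a^-1 *: (invmx A)^T in
  [/\ B \in unitmx, (invmx B)^T = a *: A & `|\det B| = `|a ^+ d * \det A|^-1].
Proof.
move=> Au a0 B.
have BA : B *m (a *: A^T) = 1%:M.
  by rewrite -scalemxAl -scalemxAr scalerA mulVf// scale1r -trmx_mul mulmxV// trmx1.
have [Bu _] := mulmx1_unit BA; split => //.
  by rewrite -[invmx B]mulmx1 -BA mulKmx// linearZ/= trmxK.
rewrite /B detZ det_tr det_inv exprVn -invfM normrV//.
by rewrite unitfE mulf_neq0 ?expf_neq0// -unitfE -unitmxE.
Qed.

Lemma lattice_tensor_error (A : 'M[R]_d) (a : R) (M : nat) :
  (0 < d)%N -> frolov A -> 0 < a -> 1 <= a ^+ d * \prod_j u j ->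
  let B := a^-1 *: (invmx A)^T in
  (forall t : d.-tuple R, (forall i, `|tnth (mxtuple B t) i| <= 2) ->
    forall i, `|tnth t i| <= M%:R) ->
  `| `|\det B| * \sum_(n : {ffun 'I_d -> 'I_M.*2.+1})
       \prod_i factor w k (u i) (z i) (tnth (mxtuple B (int_tuple (grid_point n))) i)
    - \prod_i \int[mu]_x factor w k (u i) (z i) x| <=
  Q ^+ d * ((2 ^+ d) ^+ r * (2 ^+ d + 1) * 2 ^+ d * (2 / ln 2) ^+ d.-1) *
  a ^- (r * d) * ln (2 * (a ^+ d * \prod_j u j)) ^+ d.-1.
Proof.
move=> d0 fA a0 T1 B BM.
have [Au _ _] := fA.
have [Bu BA _] := dual_lattice Au (lt0r_neq0 a0).
apply: (@lattice_sum_error _ _ B (fun i => factor w k (u i) (z i))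
  (W * K.*2.+1%:R) (3 * W * K.*2.+1%:R) 2) => //.
- by move=> i; exact: (factor_lipschitz smooth WP (z i) (u0 i) (u1 i)).
- by move=> i; exact: (factor_bound WP (z i) (u0 i) (u1 i)).
- move=> i x /(factor_supp suppw)/andP[x1 x2].
  by rewrite ler_norml; apply/andP; split; lra.
move=> N j.
pose m (l : {ffun 'I_d -> 'I_N.+1}) : 'cV[int]_d := \col_i ((j i)%:Z - (l i)%:Z).
have minj : injective m.
  move=> l l' E; apply/ffunP => i; apply/val_inj => /=.
  have := congr1 (fun x : 'cV[int]_d => x i 0) E; rewrite !mxE; lia.
have mj : m j = 0 by apply/colP => i; rewrite !mxE subrr.
have Pm l : l != j -> m l != 0 by apply: contra => /eqP lm; apply/eqP/minj; rewrite lm mj.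
have Q0 : 0 <= Q ^+ d by rewrite exprn_ge0// mulr_ge0// mulr_ge0// mulr_ge0// exprn_ge0.
have := ler_wpM2l Q0 (frolov_decay_sum d0 (isT : (2 <= r)%N) fA a0 u0 T1 minj Pm).
rewrite [X in _ <= X -> _]mulrA [X in _ <= X * _ -> _]mulrA; apply: le_trans.
rewrite mulr_sumr; apply: ler_sum => l _.
apply: (tensor_oscillation (kap := fun i => decay a (u i) (Lform A (m l) i 0))) => i;
  first exact/decay_ge0/ltW.
rewrite BA (_ : \col__ _ = map_mx intr (m l)); last first.
  by apply/colP => i'; rewrite !mxE intrD mulrNz.
have -> : (a *: A *m map_mx intr (m l)) i 0 = a * Lform A (m l) i 0.
  by rewrite -scalemxAl mxE.
have [|[L0 La]] := decayP (Lform A (m l) i 0) a0 (u0 i); [by left|right].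
have pi1 : 1 <= 2 * pi :> R by have := pi_ge2 R; lra.
split.
  by rewrite mulf_neq0 ?mulf_neq0// ?gt_eqF//; lra.
apply: le_trans La; rewrite lef_pV2 ?posrE ?mulr_gt0 ?normr_gt0//.
  rewrite normrM [X in _ <= X * _]ger0_norm; last lra.
  by rewrite normrM (gtr0_norm a0) ler_peMl// mulr_ge0// ltW.
by rewrite mulf_neq0 ?mulf_neq0// ?gt_eqF//; lra.
Qed.
End tensor.

(** * The cubature formula as a lattice sum *)

Section lattice_sums.
Context {R : realType}.
Local Notation mu := (@lebesgue_measure R).
Variable d : nat.

(** Turns a sum of finite support over Z^d into a finite one over a grid. *)
Lemma fsbig_grid M (h : 'cV[int]_d -> R) :
  (forall m, h m != 0 -> forall i, `|m i 0| <= M%:Z) ->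
  \sum_(m \in [set: 'cV[int]_d]) h m =
  \sum_(n : {ffun 'I_d -> 'I_M.*2.+1}) h (grid_point n).
Proof.
move=> hM; pose s := [seq grid_point n | n : {ffun 'I_d -> 'I_M.*2.+1}].
have us : uniq s.
  rewrite map_inj_uniq ?enum_uniq// => n n' E; apply/ffunP => i; apply/val_inj => /=.
  have := congr1 (fun x : 'cV[int]_d => x i 0) E; rewrite !mxE; lia.
transitivity (\sum_(m \in [set` s]) h m).
  apply/esym/fsbig_widen => // m [_ /= ms]; apply/eqP; apply: contra_notT ms => /hM mM.
  apply/mapP; exists [ffun i => inord (absz (m i 0 + M%:Z))]; first by rewrite mem_enum.
  apply/colP => i; rewrite !mxE ffunE; move: (m i 0) (mM i) => x xM.
  rewrite inordK; lia.
by rewrite -fsbig_seq// big_image.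
Qed.

Lemma bounded_preimage (B : 'M[R]_d) (S : R) : B \in unitmx ->
  exists M : nat, forall t : d.-tuple R, (forall i, `|tnth (mxtuple B t) i| <= S) ->
    forall i, `|tnth t i| <= M%:R.
Proof.
move=> Bu; pose s : R := \sum_i \sum_j `|invmx B i j| * S.
exists (Num.bound `|s|) => t tS i.
have [S0|S0] := ltP S 0.
  by have := le_lt_trans (tS i) S0; rewrite normr_lt0.
apply: le_trans (ltW (archi_boundP (normr_ge0 _))); rewrite (le_trans _ (ler_norm _))//.
rewrite -[t]mxtuple1 -(mulVmx Bu) mxtuple_mul tnth_mktuple.
apply: (le_trans (_ : _ <= \sum_j `|invmx B i j| * S)).
  rewrite (le_trans (ler_norm_sum _ _ _))//; apply: ler_sum => j _.
  by rewrite normrM ler_wpM2l.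
rewrite /s [leRHS](bigD1 i)//= lerDl sumr_ge0// => i' _.
by rewrite sumr_ge0// => j _; rewrite mulr_ge0.
Qed.

Variables (k : nat) (u z : 'cV[R]_d).
Local Notation r := k.+2.
Hypotheses (u0 : forall i, 0 < u i 0) (u1 : forall i, u i 0 <= 2^-1).
Hypothesis z01 : forall i, 0 <= z i 0 < 1.

Lemma prod_neq0 (a : 'I_d -> R) : \prod_i a i != 0 -> forall i, a i != 0.
Proof. by move=> /prodf_neq0 h i; exact: h. Qed.

Lemma phatd_prod (x : 'cV[R]_d) : (forall i, 0 <= x i 0 < 1) ->
  phatd r x z u = \prod_i perhat (u i 0) (z i 0) k (x i 0).
Proof.
move=> x01; rewrite /phatd (@fsbig_grid r.+1) => [|m /prod_neq0 h i]; last first.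
  by have := h i; rewrite !mxE; apply: hat_far.
rewrite /perhat bigA_distr_bigA; apply: eq_bigr => n _; apply: eq_bigr => i _.
by rewrite !mxE.
Qed.

Lemma cube_integral_phatd :
  cube_integral (fun x => phatd r x z u) =
  \prod_i \int[mu]_x (\1_(`[0, 1[%classic : set R) x * perhat (u i 0) (z i 0) k x).
Proof.
rewrite /cube_integral Rintegral_mkcond -Rintegral_tuple_prod; last first.
  by move=> i; exact: integrable_unit_perhat.
apply: eq_Rintegral => t _; rewrite patchE.
have tE i : \1_(`[0, 1[%classic : set R) (tnth t i) = (0 <= tnth t i < 1)%R%:R :> R.
  rewrite indicE (_ : (_ \in _) = (0 <= tnth t i) && (tnth t i < 1))//.
  by apply/idP/idP; rewrite inE/= in_itv.
case: ifPn => [|nt].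
  rewrite inE/= => tb; have tb' i : 0 <= (\col_j tnth t j) i 0 < 1.
    by have := tb i; rewrite !mxE.
  rewrite phatd_prod//; apply: eq_bigr => i _.
  by have := tb' i; rewrite mxE tE => ->; rewrite mul1r.
apply/esym/eqP; rewrite prodf_seq_eq0; apply: contraNT nt.
rewrite -all_predC => /allP h; rewrite inE/= => i.
have := h i; rewrite mem_index_enum/= tE !mxE => /(_ isT).
by case: (_ && _) => //; rewrite mul0r eqxx.
Qed.

Variable w : R -> R.
Hypothesis suppw : supp w `<=` `](- 2^-1), (3 / 2)[.

(** The node m has the value w * perhat at the node itself instead of at its
    fractional part, because the periodized hat does not see the difference on the
    window; the points of the lattice outside the window contribute 0. *)
Lemma cubature_grid (A : 'M[R]_d) (a : R) (M : nat) : A \in unitmx -> 0 < a ->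
  let B := a^-1 *: (invmx A)^T in
  (forall t : d.-tuple R, (forall i, `|tnth (mxtuple B t) i| <= 2) ->
    forall i, `|tnth t i| <= M%:R) ->
  cubature a A w (fun x => phatd r x z u) =
  `|\det B| * \sum_(n : {ffun 'I_d -> 'I_M.*2.+1})
    \prod_i factor w k (u i 0) (z i 0) (tnth (mxtuple B (int_tuple (grid_point n))) i).
Proof.
move=> Au a0 B BM; have [Bu _ ->] := dual_lattice Au (lt0r_neq0 a0).
rewrite normrM (ger0_norm (exprn_ge0 _ (ltW a0))); congr (_ * _).
pose node (m : 'cV[int]_d) : 'cV[R]_d := a^-1 *: ((invmx A)^T *m map_mx intr m).
have nodeE m i : tnth (mxtuple B (int_tuple m)) i = node m i 0.
  rewrite /node scalemxAl mxE tnth_mktuple; apply: eq_bigr => j _.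
  by rewrite tnth_mktuple [map_mx _ _ _ _]mxE.
have node_inj : injective node.
  move=> m m'; rewrite /node !scalemxAl => /(congr1 (mulmx (invmx B))).
  rewrite !mulKmx// => E; apply/colP => i.
  by have := congr1 (fun x : 'cV[R]_d => x i 0) E; rewrite !mxE => /intr_inj.
pose lo : 'cV[R]_d := const_mx (- 2^-1); pose hi : 'cV[R]_d := const_mx (3 / 2).
have -> : nodes a A = [set node m | m in node @^-1` box lo hi].
  apply/seteqP; split => [_ [[m _ <-] bm]|_ [m bm <-]]; first by exists m.
  by split=> //; exists m.
rewrite fsbig_image; last by move=> ? ? _ _ /node_inj.
transitivity (\sum_(m \in [set: 'cV[int]_d])
    \prod_i factor w k (u i 0) (z i 0) (node m i 0)); last first.
  rewrite (@fsbig_grid M) => [|m /prod_neq0 h i].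
    by apply: eq_bigr => n _; apply: eq_bigr => i _; rewrite nodeE.
  have := BM (int_tuple m) _ i; rewrite tnth_mktuple -intr_norm -(ler_int R); apply=> j.
  have /(factor_supp suppw)/andP[x1 x2] := h j.
  by rewrite nodeE ler_norml; apply/andP; split; lra.
transitivity (\sum_(m \in node @^-1` box lo hi)
    \prod_i factor w k (u i 0) (z i 0) (node m i 0)); last first.
  apply: fsbig_widen => // m [_ /= mb]; apply/eqP; apply: contra_notT mb => /prod_neq0 h j.
  have /(factor_supp suppw)/andP[x1 x2] := h j.
  by rewrite [lo _ _]mxE [hi _ _]mxE ltW.
apply: eq_fsbigr => m; rewrite inE => bm; rewrite phatd_prod => [|i]; last first.
  have /andP[x1 x2] := floor_itv (node m i 0); rewrite mxE subr_ge0 x1/=.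
  by rewrite ltrBlDl -[X in _ + X]mulr1z -intrD.
rewrite -big_split/=; apply: eq_bigr => i _; rewrite [Defs.frac _ _ _]mxE perhat_frac//.
by have := bm i; rewrite [lo _ _]mxE [hi _ _]mxE.
Qed.
End lattice_sums.

Theorem theorem1p2 (R : realType) (d r : nat) (hd : (2 <= d)%N)
    (hr : (2 <= r)%N) (A : 'M[R]_d) (hA : frolov A) :
  exists2 c : R, 0 < c &
  forall w : R -> R,
    infinitely_differentiable w ->
    supp w `<=` `](- 2^-1), (3 / 2)[ ->
    (forall t : R, \sum_(k \in [set: int]) w (t + k%:~R) = 1) ->
  exists C : R,
  forall a v : R, 1 < a -> c * a ^- d <= v ->
  forall u z : 'cV[R]_d,
    (forall j, 0 < u j 0 <= 2^-1) ->
    \prod_j u j 0 = v ->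
    box 0 (const_mx 1) z ->
    `|cubature a A w (fun x => phatd r x z u)
      - cube_integral (fun x => phatd r x z u)|
    <= C * a ^- (r * d) * ln (2 * v / (c * a ^- d)) ^+ d.-1.
Proof.
(* With c = 1 the condition on v says that a^d pr(u) >= 1, which is what the lattice
   sum requires. *)
exists 1 => // w smooth suppw partition1.
case: r hr => [//|[//|k]] _.
have [W W0 WP] := derivatives_bounded smooth suppw k.+2.
exists (oscillation_const k W ^+ d *
  ((2 ^+ d) ^+ k.+2 * (2 ^+ d + 1) * 2 ^+ d * (2 / ln 2) ^+ d.-1)).
move=> a v a1; rewrite mul1r => av u z u01 uv zbox.
have a0 : 0 < a by apply: lt_trans a1.
have u0 i : 0 < u i 0 by have /andP[] := u01 i.
have u1 i : u i 0 <= 2^-1 by have /andP[] := u01 i.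
have z01 i : 0 <= z i 0 < 1 by have := zbox i; rewrite !mxE.
have T1 : 1 <= a ^+ d * \prod_j u j 0.
  by rewrite uv mulrC -ler_pdivrMr ?exprn_gt0// div1r.
have [Au _ _] := hA; have [Bu _ _] := dual_lattice Au (lt0r_neq0 a0).
have [M BM] := bounded_preimage 2 Bu.
rewrite (cubature_grid k u0 u1 z01 suppw Au a0 BM) (cube_integral_phatd k u0 u1 z01).
under [X in _ - X]eq_bigr => i _.
  rewrite -(factor_mean smooth suppw partition1 WP (u0 i) (u1 i) (z01 i)); over.
have -> : 2 * v / a ^- d = 2 * (a ^+ d * \prod_j u j 0).
  by rewrite uv invrK -mulrA [v * _]mulrC.
exact: (lattice_tensor_error smooth suppw W0 WP (fun i => z i 0) u0 u1 (ltnW hd) hA a0 T1 BM).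
Qed.
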